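(* Let $(M,g)$ be a finite-dimensional Riemannian manifold with Levi-Civita connection $\nabla$. Let $K_1,K_2:TT^{(2)}M\to TM$ be the maps defined, for $u\in T^{(2)}M$, $X\in T_uT^{(2)}M$ and any smooth family of curves $\gamma(s,t)$ adapted to $X$, by $$K_1(X)=K(\tau^2_*X),\qquad K_2(X)=\tfrac12\,\nabla^2_{\partial_t\gamma}\,\partial_s\gamma\,\big|_{(s,t)=(0,0)},$$ where $K:TTM\to TM$ is the connection map of $\nabla$ on $TM$. Then $\tilde K=(K_1,K_2)$ is a connection map on $T^{(2)}M$; that is, $K_1$ and $K_2$ are fiberwise linear and satisfy $K_2\circ J=K_1$ and $K_1\circ J=\tau^1_*$, where $J$ is the canonical almost tangent structure of $T^{(2)}M$.
   Context: **Second-order tangent bundle.** $T^{(2)}M=\{u\in TTM:\tau_{TM*}(u)=\tau_{TTM}(u)\}$, where $\tau_{TM}:TM\to M$ and $\tau_{TTM}:TTM\to TM$ are the tangent bundle projections. Its elements are identified with $2$-jets $[c]$ at $t=0$ of smooth curves $c$ on $M$. The projections are $\tau^2:T^{(2)}M\to TM$, $[c]\mapsto(c(0),\dot c(0))$, and $\tau^1:T^{(2)}M\to M$, $[c]\mapsto c(0)$. **Almost tangent structure.** Given local coordinates $(q^i)$ on $M$, let $(q^i,v^i,y^i)$ be the coordinates on $T^{(2)}M$ in which the $2$-jet of $c$ has $q^i=c^i(0)$, $v^i=\dot c^i(0)$, $y^i=\tfrac12\ddot c^i(0)$. The canonical almost tangent structure $J:TT^{(2)}M\to TT^{(2)}M$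 is the (coordinate-independent) fiberwise linear map given by $J(\partial/\partial q^i)=\partial/\partial v^i$, $J(\partial/\partial v^i)=\partial/\partial y^i$, $J(\partial/\partial y^i)=0$. **Connection map on $T^{(2)}M$.** A pair $(K_1,K_2)$ of maps $K_i:TT^{(2)}M\to TM$, each restricting to a linear map $T_uT^{(2)}M\to T_{\tau^1(u)}M$ for every $u$, such that $K_2\circ J=K_1$ and $K_1\circ J=\tau^1_*$. **Connection map on $TM$.** For $X\in T_{(x,v)}TM$ and a family $\gamma(s,t)$ in $M$ with $\gamma(0,0)=x$, $\partial_t\gamma(0,0)=v$ and $\partial_s|_{s=0}(\gamma(s,0),\partial_t\gamma(s,0))=X$, set $K(X)=\nabla_{\partial_t\gamma}\partial_s\gamma|_{(0,0)}$, where $\nabla_{\partial_t\gamma}$ is the covariant derivative in $t$ of a vector field along $\gamma$. **Adapted families.** A smooth family $\gamma(s,t)$ in $M$ is adapted to $X\in T_uT^{(2)}M$ if the $2$-jet at $t=0$ of $t\mapsto\gamma(0,t)$ is $u$ and the derivative at $s=0$ of the curve in $T^{(2)}M$ sending $s$ to the $2$-jet at $t=0$ of $t\mapsto\gamma(s,t)$ is $X$. $\nabla^2_{\partial_t\gamma}\partial_s\gamma$ denotes the second iterated covariant derivative in $t$ of $\partial_s\gamma$. *)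

(* Defs.v *)
From HB Require Import structures.
From mathcomp Require Import all_boot all_order all_algebra.
From mathcomp Require Import all_classical all_reals all_analysis.
Set Implicit Arguments.
Unset Strict Implicit.
Unset Printing Implicit Defensive.
Import Order.TTheory GRing.Theory Num.Theory.
Import numFieldNormedType.Exports.
Local Open Scope classical_set_scope.
Local Open Scope ring_scope.

(* C^infinity maps between normed spaces: all iterated directional
   derivatives exist and are differentiable, at every point of a
   neighbourhood of x. *)

Definition iter_derive (R : realType) (V W : normedModType R)
  (dirs : seq V) (f : V -> W) : V -> W := foldr (fun v h => 'D_v h) f dirs.

Definition smooth_at (R : realType) (V W : normedModType R)
  (f : V -> W) (x : V) : Prop :=
  \forall y \near x, forall dirs : seq V, differentiable (iter_derive dirs f) y.

(* A family of E-valued charts on a set T, together with a choice of a chart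
   around each point; no axioms here, see [smoothManifold].  A chart i is only
   meaningful on [chart_dom i]. *)
Record chartFamily (R : realType) (E : normedModType R) (T : Type) :=
  ChartFamily {
    chart_index : Type;
    chart_dom : chart_index -> set T;
    chart_map : chart_index -> T -> E;
    chart_idx_at : T -> chart_index }.

Record chartedSpace (R : realType) (E : normedModType R) := ChartedSpace {
  pts :> choiceType;
  charts_of : chartFamily E pts }.

Section ChartedSpaces.
Context {R : realType}.

Definition index {E : normedModType R} (N : chartedSpace E) :=
  chart_index (charts_of N).

Definition dom {E : normedModType R} {N : chartedSpace E} (i : index N)
  : set N := chart_dom i.

Definition chart {E : normedModType R} {N : chartedSpace E} (i : index N)
  : N -> E := chart_map i.

Definition chart_at {E : normedModType R} {N : chartedSpace E} (x : N)
  : index N := chart_idx_at (charts_of N) x.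

(* Inverse of the chart i; takes the value x0 outside the image of dom i. *)
Definition chart_inv {E : normedModType R} {N : chartedSpace E} (x0 : N)
  (i : index N) : E -> N := 'pinv_(fun=> x0) (dom i) (chart i).

(* The tangent space T_x N is the model space E: a vector v : E stands for the
   tangent vector at x whose components in the chart chart_at x are v.
   [to_chart i x v] are its components in another chart i around x, and
   [from_chart i x e] is the vector at x with components e in the chart i. *)
Definition to_chart {E : normedModType R} {N : chartedSpace E} (i : index N)
  (x : N) (v : E) : E :=
  'd (chart i \o chart_inv x (chart_at x)) (chart (chart_at x) x) v.

Definition from_chart {E : normedModType R} {N : chartedSpace E} (i : index N)
  (x : N) (e : E) : E :=
  'd (chart (chart_at x) \o chart_inv x i) (chart i x) e.

(* Tangent bundle, with the charts (x, v) |-> (x^i, v^i) induced by the charts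
   of N. *)
Definition tangent {E : normedModType R} (N : chartedSpace E)
  : chartedSpace (E * E)%type :=
  @ChartedSpace R (E * E)%type (N * E)%type
    (@ChartFamily R (E * E)%type (N * E)%type (index N)
      (fun i p => dom i p.1)
      (fun i p => (chart i p.1, to_chart i p.1 p.2))
      (fun p => chart_at p.1)).

Definition tvec {E : normedModType R} {N : chartedSpace E} (x : N) (v : E)
  : tangent N := (x, v).

Definition tau {E : normedModType R} {N : chartedSpace E} (p : tangent N) : N :=
  p.1.

Definition fibre {E : normedModType R} {N : chartedSpace E} (p : tangent N)
  : E := p.2.

(* The tangent map f_* of a map between charted spaces. *)
Definition tangent_map {E F : normedModType R} {N : chartedSpace E}
  {P : chartedSpace F} (f : N -> P) (p : tangent N) : tangent P :=
  let x := tau p in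
  tvec (f x)
    ('d (chart (chart_at (f x)) \o f \o chart_inv x (chart_at x))
        (chart (chart_at x) x) (fibre p)).

Definition velocity {E : normedModType R} {N : chartedSpace E} (c : R -> N)
  (t : R) : tangent N :=
  tvec (c t) (derive1 (chart (chart_at (c t)) \o c) t).

(* f is smooth, as an N-valued map, on a neighbourhood of p. *)
Definition smooth_into_at {V E : normedModType R} {N : chartedSpace E}
  (f : V -> N) (p : V) : Prop :=
  (\forall z \near p, dom (chart_at (f p)) (f z)) /\
  smooth_at (chart (chart_at (f p)) \o f) p.

(* f is smooth, as a vector-valued function on N, on a neighbourhood of x. *)
Definition smooth_fun_at {E W : normedModType R} {N : chartedSpace E}
  (f : N -> W) (x : N) : Prop :=
  smooth_at (f \o chart_inv x (chart_at x)) (chart (chart_at x) x).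

(* The derivative p(f) of a function f by a tangent vector p. *)
Definition dir_derive {E W : normedModType R} {N : chartedSpace E}
  (f : N -> W) (p : tangent N) : W :=
  'd (f \o chart_inv (tau p) (chart_at (tau p)))
     (chart (chart_at (tau p)) (tau p)) (fibre p).

(* A vector field is a function Y : N -> E, with Y y in T_y N = E. *)
Definition smooth_field_at {E : normedModType R} {N : chartedSpace E}
  (Y : N -> E) (x : N) : Prop :=
  smooth_fun_at (fun y => to_chart (chart_at x) y (Y y)) x.

(* The second-order tangent bundle, as a subset of TTM. *)
Definition is_second_order {E : normedModType R} {N : chartedSpace E}
  (u : tangent (tangent N)) : Prop := tangent_map tau u = tau u.

(* The chart i of N induces on TTM the coordinates ((q, v), (q', v')), in
   which the 2-jet of c reads ((c, c'), (c', c'')); hence y = v' / 2. *)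
Definition tangent2_chart {E : normedModType R} {N : chartedSpace E}
  (i : index N) (u : tangent (tangent N)) : E * E * E :=
  let w := @chart _ (tangent (tangent N)) i u in
  (w.1.1, w.1.2, 2^-1 *: w.2.2).

Definition tangent2 {E : normedModType R} (N : chartedSpace E)
  : chartedSpace (E * E * E)%type :=
  let T := {u : tangent (tangent N) | `[< is_second_order u >]} in
  @ChartedSpace R (E * E * E)%type T
    (@ChartFamily R (E * E * E)%type T (index N)
      (fun i u => dom i (tau (tau (val u))))
      (fun i u => tangent2_chart i (val u))
      (fun u => chart_at (tau (tau (val u))))).

Definition tt_of {E : normedModType R} {N : chartedSpace E} (u : tangent2 N)
  : tangent (tangent N) := val u.

Definition tau2 {E : normedModType R} {N : chartedSpace E} (u : tangent2 N)
  : tangent N := tau (tt_of u).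

Definition tau1 {E : normedModType R} {N : chartedSpace E} (u : tangent2 N)
  : N := tau (tau2 u).

(* The 2-jet of c at 0, identified with the element c''(0) of T^(2)N. *)
Definition jet2 {E : normedModType R} {N : chartedSpace E} (c : R -> N)
  : tangent (tangent N) := velocity (velocity c) 0.

(* The vector (a, b, c) in T_u T^(2)N is a d/dq + b d/dv + c d/dy, for the
   coordinates induced by the chart of N at tau1 u; any other chart of N
   gives the same map J. *)
Definition almost_tangent {E : normedModType R} {N : chartedSpace E}
  (X : tangent (tangent2 N)) : tangent (tangent2 N) :=
  tvec (tau X) (0, (fibre X).1.1, (fibre X).1.2).

Definition fibrewise_linear {E F : normedModType R} {N : chartedSpace E}
  {P : chartedSpace F} (f : N -> P) (K : tangent N -> tangent P) : Prop :=
  (forall X, tau (K X) = f (tau X)) /\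
  (forall u : N, linear (fun xi : E => fibre (K (tvec u xi)))).

Definition is_connection_map2 {E : normedModType R} {N : chartedSpace E}
  (K1 K2 : tangent (tangent2 N) -> tangent N) : Prop :=
  [/\ fibrewise_linear tau1 K1, fibrewise_linear tau1 K2,
      forall X, K2 (almost_tangent X) = K1 X &
      forall X, K1 (almost_tangent X) = tangent_map tau1 X].

(* gamma represents X in TTN, for families gamma (s, t). *)
Definition represents {E : normedModType R} {N : chartedSpace E}
  (gamma : R * R -> N) (X : tangent (tangent N)) : Prop :=
  smooth_into_at gamma (0, 0) /\
  velocity (fun s => velocity (fun t => gamma (s, t)) 0) 0 = X.

(* C is the curve of 2-jets of the curves gamma (s, .), near s = 0. *)
Definition adapted {E : normedModType R} {N : chartedSpace E}
  (gamma : R * R -> N) (X : tangent (tangent2 N)) : Prop :=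
  [/\ smooth_into_at gamma (0, 0),
      jet2 (fun t => gamma (0, t)) = tt_of (tau X) &
      exists C : R -> tangent2 N,
        (\forall s \near 0, tt_of (C s) = jet2 (fun t => gamma (s, t))) /\
        velocity C 0 = X].

(* The field d_s gamma along the curve gamma (0, .). *)
Definition variation {E : normedModType R} {N : chartedSpace E}
  (gamma : R * R -> N) (t : R) : tangent N :=
  velocity (fun s => gamma (s, t)) 0.

End ChartedSpaces.

Record smoothManifold (R : realType) (E : normedModType R) := SmoothManifold {
  mpts : topologicalType;
  mcharts : chartFamily E mpts;
  mspace := ChartedSpace mcharts;
  mhausdorff : hausdorff_space mpts;
  msecond_countable : @second_countable mpts;
  mchart_at : forall x : mspace, dom (chart_at x) x;
  mdom_open : forall i : index mspace, open (dom i : set mpts);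
  mchart_inj : forall i : index mspace, {in dom i &, injective (chart i)};
  mchart_continuous : forall i : index mspace,
    {within (dom i : set mpts), continuous (chart i : mpts -> E)};
  mchart_open : forall (i : index mspace) (U : set mpts),
    open U -> U `<=` dom i -> open (chart i @` U);
  mtransition : forall (i j : index mspace) (x : mspace), dom i x -> dom j x ->
    smooth_at (chart j \o chart_inv x i) (chart i x) }.

Coercion manifold_space (R : realType) (E : normedModType R)
  (M : smoothManifold E) : chartedSpace E := ChartedSpace (mcharts M).

Section Riemannian.
Context {R : realType} {E : normedModType R}.

Record riemannianMetric (M : smoothManifold E) := RiemannianMetric {
  metric :> M -> E -> E -> R;
  metric_sym : forall x u v, metric x u v = metric x v u;
  metric_linear : forall x u, scalar (metric x u);
  metric_pos : forall x u, u != 0 -> 0 < metric x u u;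
  metric_smooth : forall (x : M) (Y Z : M -> E),
    smooth_field_at Y x -> smooth_field_at Z x ->
    smooth_fun_at (fun y => metric y (Y y) (Z y)) x }.

(* nabla p Y is the covariant derivative at x of the vector field Y in the
   direction p = (x, v); it is constrained for fields that are smooth near x
   only (the Leibniz rule makes it depend only on the germ of Y at x). *)
Record affineConnection (M : smoothManifold E) := AffineConnection {
  nabla_op :> tangent M -> (M -> E) -> E;
  nabla_linear : forall (x : M) (Y : M -> E), smooth_field_at Y x ->
    linear (fun v => nabla_op (tvec x v) Y);
  nabla_add : forall (p : tangent M) (Y Z : M -> E),
    smooth_field_at Y (tau p) -> smooth_field_at Z (tau p) ->
    nabla_op p (fun y => Y y + Z y) = nabla_op p Y + nabla_op p Z;
  nabla_leibniz : forall (p : tangent M) (f : M -> R) (Y : M -> E),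
    smooth_fun_at f (tau p) -> smooth_field_at Y (tau p) ->
    nabla_op p (fun y => f y *: Y y) =
      dir_derive f p *: Y (tau p) + f (tau p) *: nabla_op p Y;
  nabla_smooth : forall (x : M) (X Y : M -> E),
    smooth_field_at X x -> smooth_field_at Y x ->
    smooth_field_at (fun y => nabla_op (tvec y (X y)) Y) x }.

(* nabla_X Y - nabla_Y X = [X, Y], tested on functions. *)
Definition torsion_free (M : smoothManifold E) (nabla : affineConnection M)
  : Prop :=
  forall (x : M) (X Y : M -> E) (f : M -> R),
    smooth_field_at X x -> smooth_field_at Y x -> smooth_fun_at f x ->
    dir_derive f
      (tvec x (nabla (tvec x (X x)) Y - nabla (tvec x (Y x)) X)) =
    dir_derive (fun y => dir_derive f (tvec y (Y y))) (tvec x (X x)) -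
    dir_derive (fun y => dir_derive f (tvec y (X y))) (tvec x (Y x)).

Definition metric_compatible (M : smoothManifold E) (g : riemannianMetric M)
  (nabla : affineConnection M) : Prop :=
  forall (p : tangent M) (Y Z : M -> E),
    smooth_field_at Y (tau p) -> smooth_field_at Z (tau p) ->
    dir_derive (fun y => g y (Y y) (Z y)) p =
      g (tau p) (nabla p Y) (Z (tau p)) + g (tau p) (Y (tau p)) (nabla p Z).

Definition levi_civita (M : smoothManifold E) (g : riemannianMetric M)
  (nabla : affineConnection M) : Prop :=
  torsion_free nabla /\ metric_compatible g nabla.

(* Covariant derivative of a field W along the curve c = tau \o W.  If W is
   w^k(t) d/dx^k in the chart i at c(t), this is
   (w^k)'(t) d/dx^k + nabla_{c'(t)} (w^k(t) d/dx^k), the coefficients w^k(t)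
   of the second term being frozen at the time t. *)
Definition covariant_derivative (M : smoothManifold E)
  (nabla : affineConnection M) (W : R -> tangent M) (t : R) : tangent M :=
  let x := tau (W t) in
  let i := chart_at x in
  tvec x
    (derive1 (fun r => to_chart i (tau (W r)) (fibre (W r))) t +
     nabla (velocity (fun r => tau (W r)) t)
           (fun y => from_chart i y (fibre (W t)))).

Definition K_of_family (M : smoothManifold E) (nabla : affineConnection M)
  (gamma : R * R -> M) : tangent M :=
  covariant_derivative nabla (variation gamma) 0.

Definition K2_of_family (M : smoothManifold E) (nabla : affineConnection M)
  (gamma : R * R -> M) : tangent M :=
  let p := covariant_derivative nabla
             (covariant_derivative nabla (variation gamma)) 0 in
  tvec (tau p) (2^-1 *: fibre p).

(* K and K2 are computed from an arbitrary choice of a family; independence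
   of this choice is not built in. *)
Definition connection_K (M : smoothManifold E) (nabla : affineConnection M)
  (X : tangent (tangent M)) : tangent M :=
  xget (tau X) [set w | exists2 gamma : R * R -> M,
                  represents gamma X & w = K_of_family nabla gamma].

Definition connection_K1 (M : smoothManifold E) (nabla : affineConnection M)
  (X : tangent (tangent2 M)) : tangent M :=
  connection_K nabla (tangent_map tau2 X).

Definition connection_K2 (M : smoothManifold E) (nabla : affineConnection M)
  (X : tangent (tangent2 M)) : tangent M :=
  xget (tau2 (tau X)) [set w | exists2 gamma : R * R -> M,
                         adapted gamma X & w = K2_of_family nabla gamma].

End Riemannian.

(* Main.v *)
Require Import Defs.
From HB Require Import structures.
From mathcomp Require Import all_boot all_order all_algebra.
From mathcomp Require Import all_classical all_reals all_analysis.
From mathcomp Require Import ring.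
Import numFieldNormedType.Exports.

Set Implicit Arguments.
Unset Strict Implicit.
Unset Printing Implicit Defensive.
Import Order.TTheory GRing.Theory Num.Theory.
Local Open Scope classical_set_scope.
Local Open Scope ring_scope.

(** Everything is computed in charts. Write q, v, y for the coordinates of a
    2-jet u (so that v and 2 y are the first two derivatives of the curve) and
    a, b, d for the components of a tangent vector X at u. If F is the
    expression in a chart of a family adapted to X, then at the origin
      D_t F = v,  D_t D_t F = 2 y,  D_s F = a,  D_s D_t F = b,
      D_s D_t D_t F = 2 d.
    With Gamma the Christoffel symbols of the chart, the covariant derivative
    of a field w along a curve c is w' + Gamma(c', w)
    ([covariant_derivative_chart]). The derivatives D_t D_s and D_t D_t D_s of F
    that occur in those of the variation field are b and 2 d, by the symmetry
    of second derivatives ([schwarz], [schwarz_twice]). Hence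
      K ((q, v), (a, b)) = b + Gamma(v, a),
      K_2 X = d + (DGamma(v)(v, a) + Gamma(2 y, a) + Gamma(v, b)
                   + Gamma(v, b + Gamma(v, a))) / 2
    ([K_of_familyE], [K2_of_familyE]). The right-hand sides depend on X only,
    not on the family, and they are linear in (a, b) and (a, b, d). Replacing
    (a, b, d) by (0, a, b) turns the second formula into b + Gamma(v, a), which
    is K_1 X, and the first one, for K_1, into a. Families with prescribed jets
    exist: in a chart they are polynomial ([represents_exists],
    [adapted_exists]).

    Two points need care. The covariant derivative is defined at each time in
    the preferred chart of the point reached, so the formula for the first
    covariant derivative must be transported to one fixed chart before it can
    be differentiated again: this is [covariant_derivative_chart], whose
    content is that the second derivatives of the transition map coming from
    w' and from the Leibniz rule ([nabla_frozen_change]) cancel. And the fields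
    with constant components in a chart must be smooth as seen from the other
    charts, which rests on the smoothness of composite maps ([Ck_comp]). *)

(** * Differential calculus *)

Section Calculus.
Context {R : realType}.
Implicit Types V W : normedModType R.

Lemma near_fst (A B : topologicalType) (z : A * B) (P : A -> Prop) :
  (\forall a \near z.1, P a) -> \forall w \near z, P w.1.
Proof. by case: z => a b nP; apply: (@cvg_fst _ _ (nbhs a) (nbhs b) _ P). Qed.

Lemma near_eq_diff V W (f g : V -> W) x : {near x, f =1 g} ->
  differentiable f x ->
  differentiable g x /\ 'd g x = 'd f x :> (V -> W).
Proof.
move=> fg df; have fgx : f x = g x := nbhs_singleton fg.
have dg : g \o shift x = cst (g x) + 'd f x +o_0 id.
  apply/eqaddoP => e e0; near=> y.
  have -> : (g \o shift x - (cst (g x) + 'd f x)) y =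
            (f \o shift x - (cst (f x) + 'd f x)) y.
    rewrite /= !fctE -fgx; congr (_ - _); symmetry; near: y.
    by move: fg; rewrite (near_shift 0) /= subr0.
  near: y; have /eqaddoP := diff_locally df; exact.
have dE : 'd g x = 'd f x :> (V -> W).
  by apply: diff_unique => //; exact: diff_continuous.
by split=> //; apply/diff_locallyP; rewrite dE; split => //; exact: diff_continuous.
Unshelve. all: by end_near. Qed.

Lemma near_eq_differentiable V W (f g : V -> W) x : {near x, f =1 g} ->
  differentiable f x -> differentiable g x.
Proof. by move=> fg /(near_eq_diff fg)[]. Qed.

Lemma derive_comp (U : normedModType R) V W (f : V -> W) (g : U -> V) x u :
  differentiable g x -> differentiable f (g x) ->
  'D_u (f \o g) x = 'd f (g x) ('D_u g x).
Proof.
move=> dg df; rewrite deriveE; last exact: differentiable_comp.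
by rewrite diff_comp //= deriveE.
Qed.

Lemma near_eq_diff_comp (U : normedModType R) V W (f : V -> W) (g : U -> V)
    (h : U -> W) x y u : y = g x -> differentiable g x -> differentiable f y ->
  {near x, f \o g =1 h} -> 'd h x u = 'd f y ('d g x u).
Proof.
move=> -> dg df fgh.
have [_ ->] := near_eq_diff fgh (differentiable_comp dg df).
by rewrite diff_comp.
Qed.

Lemma is_diff_scalemap V W (f : V -> R) (g : V -> W) x :
  differentiable f x -> differentiable g x ->
  differentiable (fun y => f y *: g y) x /\
  forall h, 'D_h (fun y => f y *: g y) x = 'D_h f x *: g x + f x *: 'D_h g x.
Proof.
move=> df dg.
have sbl : bilinear_for (GRing.Scale.Law.clone _ _ *:%R _)
    (GRing.Scale.Law.clone _ _ *:%R _) (@GRing.scale R W).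
  split=> [u'|u] a x1 y1 /=.
  - by rewrite scalerDl scalerA.
  - by rewrite scalerDr !scalerA mulrC.
pose sM := bilinear_isBilinear.Build R R W W _ _ (@GRing.scale R W) sbl.
pose s : {bilinear R -> W -> W} := HB.pack (@GRing.scale R W) sM.
have sc : continuous (fun p : R * W => s p.1 p.2).
  by move=> p; exact: scale_continuous.
have -> : (fun y => f y *: g y) = (fun p => s p.1 p.2) \o (fun y => (f y, g y)).
  by [].
have dp : differentiable (fun y => (f y, g y)) x by exact: differentiable_pair.
have ds : differentiable (fun p : R * W => s p.1 p.2) (f x, g x).
  exact: differentiable_bilin.
split; first exact: differentiable_comp.
move=> h; rewrite derive_comp// diff_bilin// deriveE// diff_pair//=.
by rewrite !deriveE// addrC.
Qed.

Lemma is_diff_bigsum V W n (f : 'I_n -> V -> W) x :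
  (forall i, differentiable (f i) x) ->
  differentiable (fun y => \sum_i f i y) x /\
  forall h, 'D_h (fun y => \sum_i f i y) x = \sum_i 'D_h (f i) x.
Proof.
move=> df; have -> : (fun y => \sum_i f i y) = \sum_i f i.
  by apply/funext => y; rewrite fct_sumE.
split; first exact: differentiable_sum.
by move=> h; rewrite derive_sum// => i; exact: diff_derivable.
Qed.

Lemma derive_coord V n (f : V -> 'rV[R]_n) x h j : differentiable f x ->
  'D_h (fun y => f y 0 j) x = ('D_h f x) 0 j.
Proof. by move=> df; rewrite derive_mx ?mxE//; exact: diff_derivable. Qed.

Lemma differentiable_coord_comp V n (f : V -> 'rV[R]_n) x j :
  differentiable f x -> differentiable (fun y => f y 0 j) x.
Proof.
move=> df; apply: (@differentiable_comp _ _ _ _ f (fun N : 'rV[R]_n => N 0 j)) => //.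
exact: differentiable_coord.
Qed.

Lemma linear_zero (V W : lmodType R) (f : V -> W) : linear f -> f 0 = 0.
Proof.
move=> flin; have := flin 1 0 0; rewrite !scale1r addr0 => /eqP.
by rewrite -subr_eq subrr => /eqP.
Qed.

Lemma linear_row_sum n (F : lmodType R) (L : 'rV[R]_n -> F) (u : 'rV[R]_n) :
  linear L -> L u = \sum_j u 0 j *: L (delta_mx 0 j).
Proof.
move=> Llin; pose LM := GRing.isLinear.Build _ _ _ _ _ Llin.
pose L' : {linear _ -> _} := HB.pack L LM.
rewrite {1}[u]row_sum_delta -[L]/(L' : _ -> _) linear_sum.
by apply: eq_bigr => j _; rewrite linearZ.
Qed.

(** The product rule for a family of linear maps applied to a vector. Linearity
    is required near z only, because a connection or a transition map gives
    linear maps only at the points of its chart domain; the proof expands along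
    the canonical basis, so that no norm on linear maps is involved. *)
Lemma is_diff_linear_family V n W (L : V -> 'rV[R]_n -> W) (w : V -> 'rV[R]_n) z :
  (\near z, linear (L z)) ->
  (forall u, differentiable (fun y => L y u) z) -> differentiable w z ->
  differentiable (fun y => L y (w y)) z /\
  forall h, 'D_h (fun y => L y (w y)) z =
    'D_h (fun y => L y (w z)) z + L z ('D_h w z).
Proof.
move=> Llin dL dw.
have E (v : V -> 'rV[R]_n) :
    {near z, (fun y => \sum_j v y 0 j *: L y (delta_mx 0 j)) =1
             (fun y => L y (v y))}.
  by near=> y; rewrite -linear_row_sum//; near: y.
have dsum (v : V -> 'rV[R]_n) : differentiable v z ->
    differentiable (fun y => \sum_j v y 0 j *: L y (delta_mx 0 j)) z /\
    forall h, 'D_h (fun y => \sum_j v y 0 j *: L y (delta_mx 0 j)) z =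
     \sum_j (('D_h v z) 0 j *: L z (delta_mx 0 j) +
             v z 0 j *: 'D_h (L^~ (delta_mx 0 j)) z).
  move=> dv; have dj j := is_diff_scalemap (differentiable_coord_comp j dv)
    (dL (delta_mx 0 j)).
  have [ds Ds] := is_diff_bigsum (fun j => (dj j).1); split=> // h.
  by rewrite Ds; apply: eq_bigr => j _; rewrite (dj j).2 derive_coord.
have [dsw Dsw] := dsum w dw.
split; first exact: near_eq_differentiable (E w) dsw.
move=> h; rewrite -(near_eq_derive h (E w)) Dsw big_split/= addrC; congr (_ + _).
  have [_ Dsc] := dsum (cst (w z)) (differentiable_cst _ _).
  rewrite -(near_eq_derive h (E (cst (w z)))) Dsc; apply: eq_bigr => j _.
  by rewrite derive_cst mxE scale0r add0r.
by rewrite -linear_row_sum//; exact: nbhs_singleton Llin.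
Unshelve. all: by end_near. Qed.

(** * Smooth maps *)

(** All directional derivatives of order at most k are differentiable on U; by
    bounding the order, composites can be treated by induction. *)
Fixpoint Ck (k : nat) V W (U : set V) (f : V -> W) : Prop :=
  (forall y, U y -> differentiable f y) /\
  if k is k'.+1 then forall v, Ck k' U ('D_v f) else True.

Lemma Ck_diff k V W (U : set V) (f : V -> W) :
  Ck k U f -> forall y, U y -> differentiable f y.
Proof. by case: k => [|k] []. Qed.

Lemma CkS k V W (U : set V) (f : V -> W) : Ck k.+1 U f -> Ck k U f.
Proof.
elim: k f => [|k IH] f [df Df]; split=> //.
by move=> v; exact/IH/Df.
Qed.

Lemma Ck_sub k V W (U U' : set V) (f : V -> W) : U' `<=` U ->
  Ck k U f -> Ck k U' f.
Proof.
move=> UU'; elim: k f => [|k IH] f [df Df]; split=> //; try by move=> y /UU' /df.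
by move=> v; exact/IH/Df.
Qed.

Lemma Ck_eq k V W (U : set V) (f g : V -> W) : open U ->
  (forall y, U y -> f y = g y) -> Ck k U f -> Ck k U g.
Proof.
move=> oU; have nU y : U y -> nbhs y U by move=> Uy; apply: open_nbhs_nbhs.
elim: k f g => [|k IH] f g fg [df Df];
  have fgn y : U y -> {near y, f =1 g} by move=> /nU; apply: filterS => z /fg.
  by split=> // y Uy; exact: near_eq_differentiable (fgn y Uy) (df y Uy).
split; first by move=> y Uy; exact: near_eq_differentiable (fgn y Uy) (df y Uy).
move=> v; apply: IH (Df v) => y Uy; exact: near_eq_derive (fgn y Uy).
Qed.

Lemma Ck_cst k V W (U : set V) (c : W) : Ck k U (cst c).
Proof.
elim: k c => [|k IH] c; split=> //; do ?by move=> y _; exact: differentiable_cst.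
by move=> v; have -> : 'D_v (cst c) = cst 0 by apply/funext => y; rewrite derive_cst.
Qed.

Lemma Ck_add k V W (U : set V) (f g : V -> W) : open U ->
  Ck k U f -> Ck k U g -> Ck k U (fun y => f y + g y).
Proof.
move=> oU; elim: k f g => [|k IH] f g [df Df] [dg Dg]; split=> //;
  do ?by move=> y Uy; apply: differentiableD; [exact: df|exact: dg].
move=> v; apply: Ck_eq (IH _ _ (Df v) (Dg v)) => // y Uy.
by symmetry; apply: deriveD; apply: diff_derivable; [exact: df|exact: dg].
Qed.

Lemma Ck_sum k V W n (U : set V) (f : 'I_n -> V -> W) : open U ->
  (forall i, Ck k U (f i)) -> Ck k U (fun y => \sum_i f i y).
Proof.
move=> oU Cf; have -> : (fun y => \sum_i f i y) = \sum_i f i.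
  by apply/funext => y; rewrite fct_sumE.
elim/big_ind : _ => //; first exact: Ck_cst.
by move=> g h; exact: Ck_add.
Qed.

Lemma Ck_scale k V W (U : set V) (f : V -> R) (g : V -> W) : open U ->
  Ck k U f -> Ck k U g -> Ck k U (fun y => f y *: g y).
Proof.
move=> oU; elim: k f g => [|k IH] f g Cf Cg; have df := Ck_diff Cf;
  have dg := Ck_diff Cg; split=> //;
  do ?by move=> y Uy; case: (is_diff_scalemap (df y Uy) (dg y Uy)).
move=> v; have := Ck_add oU (IH _ _ (Cf.2 v) (CkS Cg)) (IH _ _ (CkS Cf) (Cg.2 v)).
apply: Ck_eq => // y Uy.
by have [_ ->] := is_diff_scalemap (df y Uy) (dg y Uy).
Qed.

Lemma Ck_coord k V n (U : set V) (f : V -> 'rV[R]_n) j : open U ->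
  Ck k U f -> Ck k U (fun y => f y 0 j).
Proof.
move=> oU; elim: k f => [|k IH] f [df Df]; split=> //;
  do ?by move=> y Uy; exact/differentiable_coord_comp/df.
move=> v; apply: Ck_eq (IH _ (Df v)) => // y Uy.
by rewrite derive_coord//; exact: df.
Qed.

(** By the chain rule the derivative of a composite along v is the sum over j
    of the products of the components of the derivative of the inner map by
    the partial derivatives of the outer map, composed with the inner one:
    products and composites of maps of lower order. *)
Lemma Ck_comp k V n W (U : set V) (U' : set 'rV[R]_n) (g : V -> 'rV[R]_n)
    (f : 'rV[R]_n -> W) : open U -> (forall y, U y -> U' (g y)) ->
  Ck k U g -> Ck k U' f -> Ck k U (f \o g).
Proof.
move=> oU gU; elim: k f g gU => [|k IH] f g gU Cg Cf;
  have dg := Ck_diff Cg; have df := Ck_diff Cf; split=> //;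
  do ?by move=> y Uy; apply: differentiable_comp; [exact: dg|exact/df/gU].
move=> v; have C j := Ck_scale oU (Ck_coord j oU (Cg.2 v))
    (IH _ _ gU (CkS Cg) (Cf.2 (delta_mx 0 j))).
apply: Ck_eq (Ck_sum oU C) => // y Uy.
rewrite (derive_comp v (dg y Uy) (df _ (gU y Uy))).
rewrite (linear_row_sum ('D_v g y) (linearP ('d f (g y)))).
by apply: eq_bigr => j _; rewrite /= (deriveE _ (df _ (gU y Uy))).
Qed.

(** The list of directions is consumed from its end: its last element is the
    direction of the first derivative taken. *)
Lemma Ck_iter_derive V W (U : set V) (f : V -> W) :
  (forall dirs y, U y -> differentiable (iter_derive dirs f) y) <->
  (forall k, Ck k U f).
Proof.
split=> [df k|Cf dirs].
  elim: k f df => [|k IH] f df; split=> //; do ?exact: (df [::]).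
  by move=> v; apply: IH => dirs y Uy; have := df (rcons dirs v) y Uy;
    rewrite /iter_derive foldr_rcons.
elim/last_ind: dirs f Cf => [|dirs v IH] f Cf y Uy.
  exact: (Ck_diff (Cf 0)).
by rewrite /iter_derive foldr_rcons; apply: IH => // k; exact: (Cf k.+1).2.
Qed.

Lemma smooth_atP V W (f : V -> W) x : smooth_at f x <->
  exists U : set V, [/\ open U, U x & forall k, Ck k U f].
Proof.
split.
  rewrite /smooth_at /prop_near1 nbhsE => -[U [oU Ux] Uf]; exists U; split=> //.
  by apply/Ck_iter_derive => dirs y /Uf.
move=> [U [oU Ux /Ck_iter_derive Cf]].
by near=> y => dirs; apply: Cf; near: y; exact: open_nbhs_nbhs.
Unshelve. all: by end_near. Qed.

Lemma smooth_at_near V W (f : V -> W) x :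
  smooth_at f x -> \near x, smooth_at f x.
Proof.
move=> /smooth_atP[U [oU Ux Cf]]; near=> y; apply/smooth_atP; exists U.
by split=> //; near: y; exact: open_nbhs_nbhs.
Unshelve. all: by end_near. Qed.

Lemma smooth_at_diff V W (f : V -> W) x : smooth_at f x -> differentiable f x.
Proof. by move=> /smooth_atP[U [_ Ux Cf]]; exact: Ck_diff (Cf 0) _ Ux. Qed.

Lemma smooth_at_derive V W (f : V -> W) x :
  smooth_at f x -> forall v, smooth_at ('D_v f) x.
Proof.
move=> /smooth_atP[U [oU Ux Cf]] v; apply/smooth_atP; exists U; split=> // k.
exact: (Cf k.+1).2.
Qed.

Lemma smooth_at_eq V W (f g : V -> W) x : {near x, f =1 g} ->
  smooth_at f x -> smooth_at g x.
Proof.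
rewrite /prop_near1 nbhsE => -[U' [oU' U'x] fg] /smooth_atP[U [oU Ux Cf]].
apply/smooth_atP; exists (U `&` U'); split=> //; first exact: openI.
move=> k; apply: (@Ck_eq _ _ _ _ f); first exact: openI.
  by move=> y [_ /fg].
exact: Ck_sub (Cf k).
Qed.

Lemma smooth_at_cst V W (c : W) (x : V) : smooth_at (fun=> c) x.
Proof.
by apply/smooth_atP; exists setT; split=> //; [exact: openT|move=> k; exact: Ck_cst].
Qed.

Lemma smooth_at_add V W (f g : V -> W) x :
  smooth_at f x -> smooth_at g x -> smooth_at (fun y => f y + g y) x.
Proof.
move=> /smooth_atP[U [oU Ux Cf]] /smooth_atP[U' [oU' Ux' Cg]].
have oI := openI oU oU'.
apply/smooth_atP; exists (U `&` U'); split=> // k.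
by apply: Ck_add => //; [apply: Ck_sub (Cf k)|apply: Ck_sub (Cg k)].
Qed.

Lemma smooth_at_scale V W (f : V -> R) (g : V -> W) x :
  smooth_at f x -> smooth_at g x -> smooth_at (fun y => f y *: g y) x.
Proof.
move=> /smooth_atP[U [oU Ux Cf]] /smooth_atP[U' [oU' Ux' Cg]].
have oI := openI oU oU'.
apply/smooth_atP; exists (U `&` U'); split=> // k.
by apply: Ck_scale => //; [apply: Ck_sub (Cf k)|apply: Ck_sub (Cg k)].
Qed.

Lemma smooth_at_coord V n (f : V -> 'rV[R]_n) x j :
  smooth_at f x -> smooth_at (fun y => f y 0 j) x.
Proof.
move=> /smooth_atP[U [oU Ux Cf]]; apply/smooth_atP; exists U; split=> // k.
exact: Ck_coord.
Qed.

Lemma smooth_at_comp V n W (g : V -> 'rV[R]_n) (f : 'rV[R]_n -> W) x :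
  smooth_at g x -> smooth_at f (g x) -> smooth_at (f \o g) x.
Proof.
move=> sg /smooth_atP[U' [oU' Ux' Cf]].
have gc := differentiable_continuous (smooth_at_diff sg).
have : nbhs x (g @^-1` U') by apply: gc; exact: open_nbhs_nbhs.
rewrite nbhsE => -[U2 [oU2 U2x] U2g].
move: sg => /smooth_atP[U [oU Ux Cg]]; have oI := openI oU oU2.
apply/smooth_atP; exists (U `&` U2); split=> // k.
by apply: Ck_comp (Cf k) => //; [move=> y [_ /U2g]|apply: Ck_sub (Cg k)].
Qed.

Lemma derive_line V W (f : V -> W) u c (s : R) :
  'D_1 (fun s : R => f (s *: u + c)) s = 'D_u f (s *: u + c).
Proof.
apply: (congr1 (fun q : R -> W => lim (q @ 0^'))); apply/funext => h /=.
by rewrite -[h *: 1]/(h * 1) mulr1 scalerDl addrA.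
Qed.

Lemma derivable_line V W (f : V -> W) u c (s : R) :
  derivable (fun s : R => f (s *: u + c)) s 1 = derivable f (s *: u + c) u.
Proof.
apply: (congr1 (fun q : R -> W => cvg (q @ 0^'))); apply/funext => h /=.
by rewrite -[h *: 1]/(h * 1) mulr1 scalerDl addrA.
Qed.

(** * Symmetry of second derivatives *)

(** The second difference of f on the parallelogram spanned by h u and h v is
    symmetric in u and v; the mean value theorem along u compares it with the
    increment of the derivative of f along u over h v, hence with the mixed
    second derivative up to o(h^2). *)
Lemma second_difference V (f : V -> R) x u v :
  (\near x, differentiable f x) -> differentiable ('D_u f) x ->
  forall e : R, 0 < e -> exists2 d : R, 0 < d & forall h : R, 0 < h < d ->
  `|f (h *: u + (h *: v + x)) - f (h *: u + x) - f (h *: v + x) + f x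
    - h ^+ 2 * 'D_v ('D_u f) x| <= e * h ^+ 2.
Proof.
move=> df dDf e e0; set k : R := `|u| + `|v| + 1.
have k0 : 0 < k by rewrite ltr_wpDl.
(* The increment of the derivative is the difference of its values at two points
   of norm at most k * h, each estimated with half of the error. *)
have e'0 : 0 < e / (2 * k) by rewrite divr_gt0// mulr_gt0.
have : \forall y \near (0 : V), differentiable f (y + x) /\
    `|('D_u f) (y + x) - ('D_u f x + 'd ('D_u f) x y)| <= e / (2 * k) * `|y|.
  near=> y; split.
    near: y; move: df; rewrite (near_shift 0) /= => df.
    by apply: filterS df => y /=; rewrite subr0.
  by near: y; have /eqaddoP/(_ _ e'0) := diff_locally dDf; apply.
move=> /nbhs_ballP[r /= r0 rP].
exists (r / k); first by rewrite divr_gt0.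
move=> h /andP[h0 hd].
have small (s t : R) : 0 <= s <= h -> 0 <= t <= h ->
    ball (0 : V) r (s *: u + t *: v) /\ `|s *: u + t *: v| <= k * h.
  move=> /andP[s0 sh] /andP[t0 th].
  have le : `|s *: u + t *: v| <= k * h.
    rewrite (le_trans (ler_normD _ _))// !normrZ (ger0_norm s0) (ger0_norm t0).
    rewrite /k !mulrDl mul1r -addrA lerD//.
      by rewrite mulrC ler_wpM2l.
    by rewrite ler_wpDr// ?(ltW h0)// mulrC ler_wpM2l.
  split=> //; rewrite -ball_normE /= sub0r normrN (le_lt_trans le)//.
  by rewrite mulrC -ltr_pdivlMr.
pose p (s : R) := f (s *: u + (h *: v + x)) - f (s *: u + x).
have dp s : 0 <= s <= h -> is_derive s 1 p
    ('D_u f (s *: u + (h *: v + x)) - 'D_u f (s *: u + x)).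
  move=> sh.
  have d1 : derivable f (s *: u + (h *: v + x)) u.
    apply: diff_derivable; rewrite addrA; apply: (rP _ _).1.
    by apply: (small s h _ _).1 => //; rewrite (ltW h0) lexx.
  have d2 : derivable f (s *: u + x) u.
    apply: diff_derivable; apply: (rP _ _).1.
    by have := (small s 0 sh _).1; rewrite scale0r addr0; apply; rewrite lexx ltW.
  have D c : derivable f (s *: u + c) u ->
      is_derive s 1 (fun s : R => f (s *: u + c)) ('D_u f (s *: u + c)).
    by move=> dc; rewrite -derive_line; apply: derivableP; rewrite derivable_line.
  exact: (is_deriveB (D _ d1) (D _ d2)).
have [c ch] : exists2 c, c \in `[0, h] &
    p h - p 0 = ('D_u f (c *: u + (h *: v + x)) - 'D_u f (c *: u + x)) * (h - 0).
  apply: (@MVT_segment _ p (fun s => 'D_u f (s *: u + (h *: v + x)) - 'D_u f (s *: u + x))).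
  - exact: ltW.
  - by move=> s; rewrite in_itv/= => /andP[s0 sh]; apply: dp; rewrite !ltW.
  - apply: derivable_within_continuous => s; rewrite in_itv/= => sh.
    by have [] := dp s sh.
rewrite in_itv/= in ch.
rewrite subr0 /p !scale0r !add0r => E.
have -> : f (h *: u + (h *: v + x)) - f (h *: u + x) - f (h *: v + x) + f x
  = f (h *: u + (h *: v + x)) - f (h *: u + x) - (f (h *: v + x) - f x).
  by rewrite opprB addrA; ring.
rewrite E (deriveE v dDf).
have [b1 n1] := small c h ch (introT andP (conj (ltW h0) (lexx h))).
have [b2 n2] := small c 0 ch (introT andP (conj (lexx 0) (ltW h0))).
have [_ q1] := rP _ b1; have [_ q2] := rP _ b2.
set D := 'd ('D_u f) x in q1 q2 *.
rewrite scale0r addr0 in n2 q2 b2; rewrite -addrA in q1.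
set A := ('D_u f) (c *: u + (h *: v + x)) in q1 *.
set B := ('D_u f) (c *: u + x) in q2 *.
have DZ a w : D (a *: w) = a * D w by rewrite [LHS]linearZ.
have DD w w' : D (w + w') = D w + D w' by rewrite [LHS]linearD.
rewrite DZ in q2; rewrite DD !DZ in q1.
have -> : (A - B) * h - h ^+ 2 * D v = h *
   ((A - ('D_u f x + (c * D u + h * D v))) - (B - ('D_u f x + c * D u))).
  by ring.
rewrite normrM (ger0_norm (ltW h0)).
have -> : e * h ^+ 2 = h * (e / (2 * k) * (k * h) + e / (2 * k) * (k * h)).
  by field; rewrite gt_eqF.
rewrite ler_pM2l// (le_trans (ler_normB _ _))// lerD//.
- by rewrite (le_trans q1)// ler_pM2l.
- by rewrite (le_trans q2)// ler_pM2l.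
Unshelve. all: by end_near. Qed.

Lemma schwarz_scalar V (f : V -> R) x u v :
  (\near x, differentiable f x) ->
  differentiable ('D_u f) x -> differentiable ('D_v f) x ->
  'D_v ('D_u f) x = 'D_u ('D_v f) x.
Proof.
move=> df du dv; apply/eqP; rewrite -subr_eq0 -normr_le0; apply/ler_addgt0Pr => e e0.
have e2 : 0 < e / 2 by rewrite divr_gt0.
have [d d0 dP] := second_difference v df du e2.
have [d' d'0 dP'] := second_difference u df dv e2.
pose h := Num.min d d' / 2.
have h0 : 0 < h by rewrite divr_gt0// lt_min d0.
have hm : h < Num.min d d' by rewrite ltr_pdivrMr// ltr_pMr ?ltr1n// lt_min d0.
move: hm; rewrite lt_min => /andP[hd hd'].
have := dP h; have := dP' h; rewrite h0 hd hd' => /(_ isT) + /(_ isT).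
rewrite add0r addrCA; set A := 'D_v _ x; set B := 'D_u _ x.
set a := f (h *: u + (h *: v + x)); set b := f (h *: u + x); set c := f (h *: v + x).
move=> q1 q2; rewrite -(@ler_pM2l _ (h ^+ 2)) ?exprn_gt0//.
have -> : h ^+ 2 * e = e / 2 * h ^+ 2 + e / 2 * h ^+ 2 by field.
rewrite -{1}(@ger0_norm _ (h ^+ 2)) ?exprn_ge0 ?(ltW h0)// -normrM.
have -> : h ^+ 2 * (A - B) = (a - c - b + f x - h ^+ 2 * B) - (a - b - c + f x - h ^+ 2 * A).
  by ring.
exact: le_trans (ler_normB _ _) (lerD q1 q2).
Qed.

Lemma schwarz V n (f : V -> 'rV[R]_n) x u v :
  smooth_at f x -> 'D_v ('D_u f) x = 'D_u ('D_v f) x.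
Proof.
move=> sf; have sfn := smooth_at_near sf.
have E w w' j : ('D_w ('D_w' f) x) 0 j = 'D_w ('D_w' (fun y => f y 0 j)) x.
  rewrite -derive_coord; last exact/smooth_at_diff/smooth_at_derive.
  apply: near_eq_derive; near=> y; rewrite derive_coord//.
  by apply: smooth_at_diff; near: y.
apply/rowP => j; apply: etrans (E v u j) _; apply: etrans _ (esym (E u v j)).
have df : \near x, differentiable (fun y => f y 0 j : R) x.
  by near=> y; apply/smooth_at_diff/smooth_at_coord; near: y.
have dD w : differentiable ('D_w (fun y => f y 0 j : R)) x.
  exact/smooth_at_diff/smooth_at_derive/smooth_at_coord.
exact: (schwarz_scalar df (dD u) (dD v)).
Unshelve. all: by end_near. Qed.

Lemma schwarz_twice V n (f : V -> 'rV[R]_n) x u v : smooth_at f x ->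
  'D_v ('D_v ('D_u f)) x = 'D_u ('D_v ('D_v f)) x.
Proof.
move=> sf.
have uv : {near x, 'D_v ('D_u f) =1 'D_u ('D_v f)}.
  by apply: filterS (smooth_at_near sf) => z; exact: schwarz.
have E1 := near_eq_derive v uv; have E2 := schwarz u v (smooth_at_derive sf v).
exact (eq_trans E1 E2).
Qed.

(** * Derivatives of curves and of two-parameter families *)

(** Second derivatives appear when the differential of a map, at a moving point,
    is applied to a moving vector. This is the tangent transition map, and the
    rule for the components of a field along a curve when the chart changes. *)
Lemma is_diff_differential V W n (f : 'rV[R]_n -> W) (a w : V -> 'rV[R]_n) z :
  smooth_at f (a z) -> differentiable a z -> differentiable w z ->
  differentiable (fun y => 'd f (a y) (w y)) z /\
  forall h, 'D_h (fun y => 'd f (a y) (w y)) z =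
    'D_('D_h a z) ('D_(w z) f) (a z) + 'd f (a z) ('D_h w z).
Proof.
move=> sf da dw; have ac := differentiable_continuous da.
have E u : {near z, 'D_u f \o a =1 (fun y => 'd f (a y) u)}.
  have : \forall y \near z, smooth_at f (a y) by exact: ac _ (smooth_at_near sf).
  by apply: filterS => y sy; rewrite /= deriveE//; exact: smooth_at_diff.
have dDf u : differentiable ('D_u f) (a z) by exact/smooth_at_diff/smooth_at_derive.
have dC u := differentiable_comp da (dDf u).
have Llin : \forall y \near z, linear (fun u => 'd f (a y) u).
  by near=> y; exact: linearP.
have [d D] := is_diff_linear_family Llin
  (fun u => near_eq_differentiable (E u) (dC u)) dw.
split=> // h; apply: etrans (D h) _.
have -> : 'D_h (fun y => 'd f (a y) (w z)) z = 'D_('D_h a z) ('D_(w z) f) (a z).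
  apply: etrans (esym (near_eq_derive h (E (w z)))) _.
  by rewrite derive_comp// -deriveE.
by [].
Unshelve. all: by end_near. Qed.

Lemma derive1_comp_curve V W (f : V -> W) (c : R -> V) (t : R) :
  differentiable f (c t) -> derivable c t 1 ->
  derivable (f \o c) t 1 /\ derive1 (f \o c) t = 'D_(derive1 c t) f (c t).
Proof.
move=> df /derivable1_diffP dc; split.
  by apply/derivable1_diffP; exact: differentiable_comp.
by rewrite !derive1E derive_comp// -deriveE.
Qed.

Lemma derive1_add V (f g : R -> V) (t : R) : derivable f t 1 -> derivable g t 1 ->
  derivable (fun r => f r + g r) t 1 /\
  derive1 (fun r => f r + g r) t = derive1 f t + derive1 g t.
Proof.
by move=> df dg; split; [exact: derivableD|rewrite !derive1E; exact: deriveD].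
Qed.

Lemma derive1_differential W n (f : 'rV[R]_n -> W) (c w : R -> 'rV[R]_n) (t : R) :
  smooth_at f (c t) -> derivable c t 1 -> derivable w t 1 ->
  derivable (fun r => 'd f (c r) (w r)) t 1 /\
  derive1 (fun r => 'd f (c r) (w r)) t =
    'D_(derive1 c t) ('D_(w t) f) (c t) + 'd f (c t) (derive1 w t).
Proof.
move=> sf /derivable1_diffP dc /derivable1_diffP dw.
have [d D] := is_diff_differential sf dc dw; split; first exact/derivable1_diffP.
by rewrite !derive1E; exact: D.
Qed.

Lemma derive1_linear_family n W (L : R -> 'rV[R]_n -> W) (w : R -> 'rV[R]_n) (t : R) :
  (\forall r \near t, linear (L r)) ->
  (forall u, derivable (fun r => L r u) t 1) -> derivable w t 1 ->
  derivable (fun r => L r (w r)) t 1 /\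
  derive1 (fun r => L r (w r)) t =
    derive1 (fun r => L r (w t)) t + L t (derive1 w t).
Proof.
move=> Llin dL /derivable1_diffP dw.
have [d D] := is_diff_linear_family Llin (fun u => (derivable1_diffP _ _).1 (dL u)) dw.
split; first exact/derivable1_diffP.
by rewrite !derive1E; exact: D.
Qed.

Lemma is_diff_linear_map V W (f : V -> W) x : linear f -> continuous f ->
  differentiable f x /\ forall w, 'D_w f x = f w.
Proof.
move=> flin fc; pose fM := GRing.isLinear.Build _ _ _ _ _ flin.
pose f' : {linear _ -> _} := HB.pack f fM; rewrite -[f]/(f' : _ -> _).
have df : differentiable f' x by exact: linear_differentiable.
by split=> // w; rewrite deriveE// diff_lin.
Qed.

Lemma near_eq_diff_linear V W (f g : V -> W) x w : linear g -> continuous g ->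
  {near x, g =1 f} -> 'd f x w = g w.
Proof.
move=> glin gc gf; have [dg Dg] := is_diff_linear_map x glin gc.
by have [_ ->] := near_eq_diff gf dg; rewrite -deriveE.
Qed.

Lemma derive1_pair V W (f : R -> V) (g : R -> W) t :
  derivable f t 1 -> derivable g t 1 ->
  derivable (fun r => (f r, g r)) t 1 /\
  derive1 (fun r => (f r, g r)) t = (derive1 f t, derive1 g t).
Proof.
move=> /derivable1_diffP df /derivable1_diffP dg.
have dp := differentiable_pair df dg; split; first exact/derivable1_diffP.
by rewrite !derive1E'// diff_pair.
Qed.

Lemma derivable1_continuous V (f : R -> V) (t : R) : derivable f t 1 ->
  {for t, continuous f}.
Proof. by move=> /derivable1_diffP; exact: differentiable_continuous. Qed.

Lemma derive1_scale V (f : R -> V) (k t : R) : derivable f t 1 ->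
  derivable (fun r => k *: f r) t 1 /\
  derive1 (fun r => k *: f r) t = k *: derive1 f t.
Proof.
by move=> df; split; [exact: derivableZ|rewrite !derive1E; exact: deriveZ].
Qed.

Lemma derive1_comp_fst V W (f : R -> V * W) t : derivable f t 1 ->
  derive1 (fst \o f) t = (derive1 f t).1.
Proof.
move=> /derivable1_diffP df.
have [d D] : differentiable (fst : V * W -> V) (f t) /\
    forall w, 'D_w (fst : V * W -> V) (f t) = w.1.
  by apply: is_diff_linear_map => // z; exact: cvg_fst.
by rewrite !derive1E derive_comp// -deriveE.
Qed.

Lemma derive1_near_eq V (f g : R -> V) t : {near t, f =1 g} ->
  derive1 f t = derive1 g t.
Proof. by move=> fg; rewrite !derive1E; exact: near_eq_derive. Qed.

Lemma derive1_fst V (G : R * R -> V) (s t : R) :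
  derive1 (fun r => G (r, t)) s = 'D_(1, 0) G (s, t).
Proof.
have E (r : R) : (r, t) = r *: (1, 0) + (0, t) :> R * R.
  by congr pair; rewrite /= ?scaler0 ?addr0 ?add0r// -[_ *: _]/(_ * _) mulr1.
rewrite derive1E E -derive_line; apply: (congr1 (fun q : R -> V => 'D_1 q _)).
by apply/funext => r; rewrite E.
Qed.

Lemma derive1_snd V (G : R * R -> V) (s t : R) :
  derive1 (fun r => G (s, r)) t = 'D_(0, 1) G (s, t).
Proof.
have E (r : R) : (s, r) = r *: (0, 1) + (s, 0) :> R * R.
  by congr pair; rewrite /= ?scaler0 ?addr0 ?add0r// -[_ *: _]/(_ * _) mulr1.
rewrite derive1E E -derive_line; apply: (congr1 (fun q : R -> V => 'D_1 q _)).
by apply/funext => r; rewrite E.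
Qed.

Lemma derivable_fst V (G : R * R -> V) (s t : R) : differentiable G (s, t) ->
  derivable (fun r => G (r, t)) s 1.
Proof.
move=> dG; apply/derivable1_diffP.
apply: (@differentiable_comp _ _ _ _ (fun r : R => (r, t)) G) => //.
Qed.

Lemma derivable_snd V (G : R * R -> V) (s t : R) : differentiable G (s, t) ->
  derivable (fun r => G (s, r)) t 1.
Proof.
move=> dG; apply/derivable1_diffP.
apply: (@differentiable_comp _ _ _ _ (fun r : R => (s, r)) G) => //.
Qed.

Lemma derive1_fst_pair V W (G : R * R -> V) (H : R * R -> W) (s t : R) :
  differentiable G (s, t) -> differentiable H (s, t) ->
  derivable (fun r => (G (r, t), H (r, t))) s 1 /\
  derive1 (fun r => (G (r, t), H (r, t))) s = ('D_(1, 0) G (s, t), 'D_(1, 0) H (s, t)).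
Proof.
move=> dG dH; have [d D] := derive1_pair (derivable_fst dG) (derivable_fst dH).
by split=> //; rewrite -!derive1_fst.
Qed.

Lemma derive1_snd_fst n (F : R * R -> 'rV[R]_n) (s t : R) : smooth_at F (s, t) ->
  derive1 (fun r => 'D_(1, 0) F (s, r)) t = 'D_(1, 0) ('D_(0, 1) F) (s, t).
Proof. by move=> sF; rewrite (derive1_snd ('D_(1, 0) F)); exact: schwarz. Qed.

Lemma derive1_snd_snd_fst n (F : R * R -> 'rV[R]_n) (s t : R) : smooth_at F (s, t) ->
  derive1 (fun r => 'D_(0, 1) ('D_(1, 0) F) (s, r)) t =
    'D_(1, 0) ('D_(0, 1) ('D_(0, 1) F)) (s, t).
Proof.
by move=> sF; rewrite (derive1_snd ('D_(0, 1) ('D_(1, 0) F))); exact: schwarz_twice.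
Qed.

Lemma near_slice_fst (s t : R) (P : R * R -> Prop) :
  (\forall z \near (s, t), P z) -> \forall r \near s, P (r, t).
Proof.
have d : differentiable (fun r : R => (r, t)) s by [].
exact: (differentiable_continuous d).
Qed.

Lemma near_slice_snd (s t : R) (P : R * R -> Prop) :
  (\forall z \near (s, t), P z) -> \forall r \near t, P (s, r).
Proof.
have d : differentiable (fun r : R => (s, r)) t by [].
exact: (differentiable_continuous d).
Qed.

(** * Polynomial families *)

(** The polynomial families used to realize prescribed derivatives; the form
    is stable under differentiation. *)
Definition family_poly (E : normedModType R) (c0 c1 c2 c3 c4 c5 : E) (p : R * R) : E :=
  c0 + p.1 *: c1 + p.2 *: c2 + (p.1 * p.2) *: c3 + (p.2 * p.2) *: c4
     + (p.1 * p.2 * p.2) *: c5.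

Lemma near_derive V W (f g : V -> W) (x : V) : {near x, f =1 g} ->
  forall v, {near x, 'D_v f =1 'D_v g}.
Proof. by move=> /near_join fg v; apply: filterS fg => y; exact: near_eq_derive. Qed.

Lemma is_diff_family_poly (E : normedModType R) (c0 c1 c2 c3 c4 c5 : E) p :
  differentiable (family_poly c0 c1 c2 c3 c4 c5) p /\
  forall w, 'D_w (family_poly c0 c1 c2 c3 c4 c5) p =
    family_poly (w.1 *: c1 + w.2 *: c2) (w.2 *: c3)
      (w.1 *: c3 + (2 * w.2) *: c4) ((2 * w.2) *: c5) (w.1 *: c5) 0 p.
Proof.
have [df Df] : differentiable (fst : R * R -> R) p /\
    forall w, 'D_w (fst : R * R -> R) p = w.1.
  by apply: is_diff_linear_map; [move=> ? ? ?|move=> z; exact: cvg_fst].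
have [ds Ds] : differentiable (snd : R * R -> R) p /\
    forall w, 'D_w (snd : R * R -> R) p = w.2.
  by apply: is_diff_linear_map; [move=> ? ? ?|move=> z; exact: cvg_snd].
have add W (f g : R * R -> W) a b :
    differentiable f p /\ (forall w, 'D_w f p = a w) ->
    differentiable g p /\ (forall w, 'D_w g p = b w) ->
    differentiable (fun q => f q + g q) p /\
    (forall w, 'D_w (fun q => f q + g q) p = a w + b w).
  move=> [d1 D1] [d2 D2]; split; first exact: differentiableD.
  by move=> w; rewrite -D1 -D2; apply: deriveD; exact: diff_derivable.
have scl W (f : R * R -> R) (g : R * R -> W) a b :
    differentiable f p /\ (forall w, 'D_w f p = a w) ->
    differentiable g p /\ (forall w, 'D_w g p = b w) ->
    differentiable (fun q => f q *: g q) p /\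
    (forall w, 'D_w (fun q => f q *: g q) p = a w *: g p + f p *: b w).
  move=> [d1 D1] [d2 D2]; have [d D] := is_diff_scalemap d1 d2.
  by split=> // w; rewrite D D1 D2.
have cst W (c : W) : differentiable (fun=> c : W) p /\
    (forall w, 'D_w (fun _ : R * R => c) p = 0).
  by split; [exact: differentiable_cst|move=> w; exact: derive_cst].
have fs := conj df Df; have sn := conj ds Ds.
have [d D] := add _ _ _ _ _ (add _ _ _ _ _ (add _ _ _ _ _ (add _ _ _ _ _
  (add _ _ _ _ _ (cst _ c0) (scl _ _ _ _ _ fs (cst _ c1)))
  (scl _ _ _ _ _ sn (cst _ c2)))
  (scl _ _ _ _ _ (scl _ _ _ _ _ fs sn) (cst _ c3)))
  (scl _ _ _ _ _ (scl _ _ _ _ _ sn sn) (cst _ c4)))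
  (scl _ _ _ _ _ (scl _ _ _ _ _ (scl _ _ _ _ _ fs sn) sn) (cst _ c5)).
split; first exact: d.
move=> w; apply: etrans (D w) _.
rewrite /family_poly !scaler0 !addr0 add0r.
rewrite -[w.1 *: p.2]/(w.1 * p.2) -[p.1 *: w.2]/(p.1 * w.2).
rewrite -[w.2 *: p.2]/(w.2 * p.2) -[p.2 *: w.2]/(p.2 * w.2).
rewrite -[_ *: p.2]/(_ * p.2) -[(p.1 *: p.2) *: w.2]/(p.1 * p.2 * w.2).
rewrite !scalerDr !scalerA -!addrA; congr (_ + _); congr (_ + _).
rewrite [RHS]addrA -!scalerDl; congr (_ *: _ + (_ *: _ + _ *: _)); ring.
Qed.

Lemma derive_family_poly (E : normedModType R) (c0 c1 c2 c3 c4 c5 : E) w :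
  'D_w (family_poly c0 c1 c2 c3 c4 c5) =
    family_poly (w.1 *: c1 + w.2 *: c2) (w.2 *: c3)
      (w.1 *: c3 + (2 * w.2) *: c4) ((2 * w.2) *: c5) (w.1 *: c5) 0.
Proof. by apply/funext => p; case: (is_diff_family_poly c0 c1 c2 c3 c4 c5 p). Qed.

Lemma family_poly0 (E : normedModType R) (c0 c1 c2 c3 c4 c5 : E) :
  family_poly c0 c1 c2 c3 c4 c5 (0, 0) = c0.
Proof. by rewrite /family_poly /= !mul0r !scale0r !addr0. Qed.

Lemma family_poly_jet (E : normedModType R) (c0 c1 c2 c3 c4 c5 : E) (f : R * R -> E) :
  {near (0, 0), family_poly c0 c1 c2 c3 c4 c5 =1 f} ->
  (f (0, 0) = c0 /\ 'D_(1, 0) f (0, 0) = c1) /\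
  [/\ 'D_(0, 1) f (0, 0) = c2, 'D_(1, 0) ('D_(0, 1) f) (0, 0) = c3,
     'D_(0, 1) ('D_(0, 1) f) (0, 0) = 2 *: c4 &
     'D_(1, 0) ('D_(0, 1) ('D_(0, 1) f)) (0, 0) = 2 *: c5].
Proof.
move=> qf; have qft := near_derive qf (0, 1); have qftt := near_derive qft (0, 1).
have simp := (scale0r, scale1r, mulr0, mulr1, scaler0, addr0, add0r, family_poly0).
rewrite -(nbhs_singleton qf) -(nbhs_singleton (near_derive qf (1, 0))).
rewrite -(nbhs_singleton qft) -(nbhs_singleton (near_derive qft (1, 0))).
rewrite -(nbhs_singleton qftt) -(nbhs_singleton (near_derive qftt (1, 0))).
have D a0 a1 a2 a3 a4 a5 w p := (is_diff_family_poly a0 a1 a2 a3 a4 a5 p).2 w : (_ : E) = _.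
by rewrite !derive_family_poly !D /family_poly /= !simp.
Qed.

Lemma smooth_at_family_poly (E : normedModType R) (c0 c1 c2 c3 c4 c5 : E) p :
  smooth_at (family_poly c0 c1 c2 c3 c4 c5) p.
Proof.
apply/smooth_atP; exists setT; split=> //; first exact: openT.
move=> k; elim: k c0 c1 c2 c3 c4 c5 => [|k IH] c0 c1 c2 c3 c4 c5; split=> //;
  do ?by move=> y _; case: (is_diff_family_poly c0 c1 c2 c3 c4 c5 y).
move=> w; apply: Ck_eq (IH _ _ _ _ _ _); first exact: openT.
by move=> y _; case: (is_diff_family_poly c0 c1 c2 c3 c4 c5 y).
Qed.

End Calculus.

(** * Charts *)

Local Notation index := Defs.index.

Section Charts.
Context {R : realType} {E : normedModType R}.
Implicit Types N : chartedSpace E.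

(** What the calculus of curves in charts needs: charts are injective and
    transition maps are differentiable. *)
Definition differentiable_atlas N :=
  (forall i : index N, {in dom i &, injective (chart i)}) /\
  forall (i j : index N) (x x0 : N), dom i x -> dom j x ->
    differentiable (chart j \o chart_inv x0 i) (chart i x).

Lemma chart_invK N (x0 : N) (i : index N) y :
  {in dom i &, injective (chart i)} -> dom i y ->
  chart_inv x0 i (chart i y) = y.
Proof.
by move=> inj iy; rewrite /chart_inv; apply: pinvKV => //; rewrite in_setE.
Qed.

Lemma chart_inv_image N (x0 : N) (i : index N) e : (chart i @` dom i) e ->
  chart i (chart_inv x0 i e) = e /\ dom i (chart_inv x0 i e).
Proof.
move=> ie; split; first by apply: pinvK; rewrite in_setE.
have sub : set_surj (dom i) (chart i @` dom i) (chart i) by move=> z.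
by have := surjpinv_image_sub (dflt := fun=> x0) sub; apply; exists e.
Qed.

Lemma chart_change_curve N (x0 : N) (i j : index N) (c : R -> N) t :
  {in dom i &, injective (chart i)} -> (\near t, dom i (c t)) ->
  differentiable (chart j \o chart_inv x0 i) (chart i (c t)) ->
  derivable (chart i \o c) t 1 ->
  derivable (chart j \o c) t 1 /\
  derive1 (chart j \o c) t =
    'd (chart j \o chart_inv x0 i) (chart i (c t)) (derive1 (chart i \o c) t).
Proof.
move=> inj ci dij /derivable1_diffP dc.
have E1 : {near t, (chart j \o chart_inv x0 i) \o (chart i \o c) =1 chart j \o c}.
  near=> r; rewrite /= chart_invK//; by near: r.
have d : differentiable ((chart j \o chart_inv x0 i) \o (chart i \o c)) t.
  exact: differentiable_comp.
split; first by apply/derivable1_diffP; apply: near_eq_differentiable d.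
rewrite derive1E -(near_eq_derive _ E1) derive_comp// derive1E.
Unshelve. all: by end_near. Qed.

Lemma velocity_to_chart N (c : R -> N) t (i : index N) :
  differentiable_atlas N -> (\near t, dom i (c t)) ->
  (\forall r \near t, dom (chart_at (c t)) (c r)) ->
  derivable (chart i \o c) t 1 ->
  derivable (chart (chart_at (c t)) \o c) t 1 /\
  to_chart i (c t) (fibre (velocity c t)) = derive1 (chart i \o c) t.
Proof.
move=> [inj dif] ci cj dc; set j := chart_at (c t) in cj *.
have ict : dom i (c t) := nbhs_singleton ci.
have jct : dom j (c t) := nbhs_singleton cj.
have [dj Dj] := chart_change_curve (inj i) ci (dif i j _ (c t) ict jct) dc.
have [_ Di] := chart_change_curve (inj j) cj (dif j i _ (c t) jct ict) dj.
by rewrite Di.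
Qed.

End Charts.

(** * Charts of a manifold and of its tangent bundle *)

Section Manifold.
Context {R : realType} {n : nat} (M : smoothManifold 'rV[R]_n).
Local Notation E := 'rV[R]_n.
Local Notation chartT := (@chart R (E * E)%type (tangent M)).
Local Notation chart_invT := (@chart_inv R (E * E)%type (tangent M)).
Local Notation domT := (@dom R (E * E)%type (tangent M)).
Implicit Types (i j k : index M) (x y : M).

Lemma inj_chart i : {in dom i &, injective (chart i)}.
Proof. exact: mchart_inj. Qed.

Lemma dom_chart_at x : dom (chart_at x) x.
Proof. exact: mchart_at. Qed.

Lemma near_dom i x : dom i x -> \forall y \near (x : mpts M), dom i (y : M).
Proof. by move=> ix; apply: open_nbhs_nbhs; split=> //; exact: mdom_open. Qed.

(** Charts are open maps, so that a property of the points near x can be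
    transferred to the coordinates near those of x. *)
Lemma near_image i x (P : M -> Prop) : dom i x ->
  (\forall y \near (x : mpts M), P y) ->
  \forall e \near chart i x, exists y, [/\ dom i y, P y & e = chart i y].
Proof.
move=> ix nP; have : nbhs (x : mpts M) ((dom i : set (mpts M)) `&` P).
  by apply: filterI => //; exact: near_dom.
rewrite nbhsE => -[U [oU Ux] UP].
have oi : open (chart i @` U) by apply: mchart_open => // y /UP[].
have : nbhs (chart i x) (chart i @` U) by apply: open_nbhs_nbhs; split=> //; exists x.
by apply: filterS => e [y /UP[iy Py] <-]; exists y.
Qed.

Lemma near_chart_inv i x x0 (P : M -> Prop) : dom i x ->
  (\forall y \near (x : mpts M), P y) ->
  \forall e \near chart i x, P (chart_inv x0 i e).
Proof.
move=> ix nP; have := near_image ix nP.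
by apply: filterS => e [y [iy Py ->]]; rewrite chart_invK//; exact: inj_chart.
Qed.

(** A map into the manifold that is continuous in one chart is continuous. *)
Lemma near_map (V : topologicalType) (f : V -> M) (v : V) i (P : M -> Prop) :
  (\near v, dom i (f v)) -> {for v, continuous (chart i \o f)} ->
  (\forall y \near (f v : mpts M), P y) -> \near v, P (f v).
Proof.
move=> fi fc nP; have fiv : dom i (f v) := nbhs_singleton fi.
have := fc _ (near_image fiv nP) => fP.
near=> w; have [y [iy Py]] : exists y, [/\ dom i y, P y & chart i (f w) = chart i y].
  by near: w.
have iw : dom i (f w) by near: w.
by move=> /inj_chart; rewrite !in_setE => /(_ iw iy) ->.
Unshelve. all: by end_near. Qed.

Lemma smooth_transition i j x x0 : dom i x -> dom j x ->
  smooth_at (chart j \o chart_inv x0 i) (chart i x).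
Proof.
move=> ix jx; have := mtransition ix jx; apply: smooth_at_eq.
have := near_image ix (near_dom ix); apply: filterS => e [y [_ iy ->]].
by rewrite /= !chart_invK//; exact: inj_chart.
Qed.

Lemma manifold_atlas : differentiable_atlas M.
Proof.
split; first exact: inj_chart.
by move=> i j x x0 ix jx; exact/smooth_at_diff/smooth_transition.
Qed.

(** The differential at y of the transition map from the chart i to the chart
    j; to_chart and from_chart are the instances where one of the charts is the
    preferred one. *)
Definition dtrans i j (y : M) : E -> E :=
  'd (chart j \o chart_inv y i) (chart i y).

Lemma to_chartE i y : to_chart i y = dtrans (chart_at y) i y.
Proof. by []. Qed.

Lemma from_chartE i y : from_chart i y = dtrans i (chart_at y) y.
Proof. by []. Qed.

Lemma dtransE x0 i j y : dom i y -> dom j y ->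
  'd (chart j \o chart_inv x0 i) (chart i y) = dtrans i j y :> (E -> E).
Proof.
move=> iy jy; apply: (near_eq_diff _ (smooth_at_diff (smooth_transition y iy jy))).2.
have := near_image iy (near_dom iy); apply: filterS => e [z [_ iz ->]].
by rewrite /= !chart_invK//; exact: inj_chart.
Qed.

Lemma dtrans_id i y v : dom i y -> dtrans i i y v = v.
Proof.
move=> iy; rewrite /dtrans; have [_ ->] : differentiable (chart i \o chart_inv y i) (chart i y) /\
    'd (chart i \o chart_inv y i) (chart i y) = 'd (@id E) (chart i y) :> (E -> E).
  apply: near_eq_diff => //.
  have := near_image iy (near_dom iy); apply: filterS => e [z [_ iz ->]].
  by rewrite /= !chart_invK//; exact: inj_chart.
by rewrite diff_val.
Qed.

Lemma dtrans_comp i j k y v : dom i y -> dom j y -> dom k y ->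
  dtrans j k y (dtrans i j y v) = dtrans i k y v.
Proof.
move=> iy jy ky; have dij := smooth_at_diff (smooth_transition y iy jy).
have djk := smooth_at_diff (smooth_transition y jy ky).
have E0 : chart j y = (chart j \o chart_inv y i) (chart i y).
  by rewrite /= chart_invK//; exact: inj_chart.
have near : {near chart i y, (chart k \o chart_inv y j) \o
    (chart j \o chart_inv y i) =1 chart k \o chart_inv y i}.
  have := near_image iy (near_dom jy); apply: filterS => e [z [iz jz ->]].
  by rewrite /= !chart_invK//; exact: inj_chart.
exact: esym (near_eq_diff_comp v E0 dij djk near).
Qed.

Lemma tangent_chartE i (p : tangent M) :
  chartT i p = (chart i (tau p), to_chart i (tau p) (fibre p)).
Proof. by []. Qed.

(** On the fibres an induced chart is the differential of a transition map,
    which is invertible. *)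
Lemma inj_tangent_chart i : {in domT i &, injective (chartT i)}.
Proof.
move=> [x v] [y w]; rewrite !in_setE => ix iy; rewrite !tangent_chartE /= => -[].
move=> /inj_chart; rewrite !in_setE => /(_ ix iy) xy; subst y.
rewrite !to_chartE => /(congr1 (dtrans i (chart_at x) x)).
have cx := dom_chart_at x; change (dom i x) in ix.
by rewrite !dtrans_comp// !dtrans_id// => ->.
Qed.

Lemma tangent_chart_from_chart i y v : dom i y ->
  chartT i (tvec y (from_chart i y v)) = (chart i y, v).
Proof.
move=> iy; have cy := dom_chart_at y.
by rewrite tangent_chartE to_chartE/= from_chartE dtrans_comp// dtrans_id.
Qed.

Lemma near_tangent_image i (p : tangent M) (P : M -> Prop) : dom i (tau p) ->
  (\forall y \near (tau p : mpts M), P y) ->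
  \forall z \near chartT i p, exists y v, [/\ dom i y, P y & z = (chart i y, v)].
Proof.
move=> ip nP; have := near_image ip nP => nP'.
have : \forall z \near chartT i p, exists y, [/\ dom i y, P y & z.1 = chart i y].
  exact: (@near_fst _ _ (chartT i p) _ nP').
by apply: filterS => -[e v] [y [iy Py /= ->]]; exists y, v.
Qed.

(** The transition maps of the tangent bundle are (e, v) |-> (f e, f'(e) v),
    for f a transition map of the manifold. *)
Lemma tangent_transition i j (p p0 : tangent M) : dom i (tau p) -> dom j (tau p) ->
  {near chartT i p, (fun z : E * E => ((chart j \o chart_inv (tau p) i) z.1,
      'd (chart j \o chart_inv (tau p) i) (z.1) z.2)) =1 chartT j \o chart_invT p0 i}.
Proof.
move=> ip jp; have := near_tangent_image ip (near_dom jp).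
apply: filterS => z [y [v [iy jy ->]]] /=.
rewrite -(tangent_chart_from_chart v iy).
rewrite (chart_invK p0 (@inj_tangent_chart i) (y := tvec y (from_chart i y v)))//.
rewrite (chart_invK _ (@inj_chart i))// dtransE// tangent_chartE/=.
have cy := dom_chart_at y.
by rewrite to_chartE from_chartE dtrans_comp.
Qed.

Lemma tangent_atlas : differentiable_atlas (tangent M).
Proof.
split; first exact: inj_tangent_chart.
suff key i j (p p0 : tangent M) : dom i (tau p) -> dom j (tau p) ->
    differentiable (chartT j \o chart_invT p0 i) (chartT i p).
  by move=> i j p p0; exact: key.
move=> ip jp; apply: near_eq_differentiable (tangent_transition p0 ip jp) _.
set f := chart j \o chart_inv (tau p) i; set z0 := chartT i p.
have sf : smooth_at f z0.1 by exact: smooth_transition.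
have dfst : differentiable (fst : E * E -> E) z0.
  by apply: (is_diff_linear_map z0 _ _).1 => // z; exact: cvg_fst.
have dsnd : differentiable (snd : E * E -> E) z0.
  by apply: (is_diff_linear_map z0 _ _).1 => // z; exact: cvg_snd.
apply: differentiable_pair.
  by apply: (@differentiable_comp _ _ _ _ (fst : E * E -> E) f) => //; exact: smooth_at_diff.
exact: (is_diff_differential sf dfst dsnd).1.
Qed.

Lemma tangent_map_tau (u : tangent (tangent M)) :
  tangent_map tau u = tvec (tau (tau u)) (fibre u).1.
Proof.
case: u => p w; set i := chart_at (tau p); have ip : dom i (tau p) := dom_chart_at _.
congr pair; apply: (near_eq_diff_linear (g := (fst : E * E -> E))) => //.
  by move=> z; exact: cvg_fst.
have := near_tangent_image ip (near_dom ip).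
apply: filterS => _ [y [v [iy _ ->]]] /=.
rewrite -(tangent_chart_from_chart v iy).
by rewrite (chart_invK _ (@inj_tangent_chart i) (y := tvec y _)).
Qed.

(** * Jets of curves and families *)

(** At each time the velocity is given by its components in the preferred chart
    of the point reached, and this chart may change discontinuously; the
    components in one fixed chart are nevertheless the derivative of the curve
    in that chart. *)
Lemma near_velocity_to_chart (c : R -> M) (t : R) i :
  (\near t, dom i (c t)) -> (\near t, derivable (chart i \o c) t 1) ->
  \forall r \near t,
    to_chart i (c r) (fibre (velocity c r)) = derive1 (chart i \o c) r.
Proof.
move=> ci dc; have cin := near_join ci; near=> r.
have dr : derivable (chart i \o c) r 1 by near: r.
have cir : \forall r' \near r, dom i (c r') by near: r.
apply: (velocity_to_chart manifold_atlas cir _ dr).2.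
apply: (near_map cir); last by apply: near_dom; exact: dom_chart_at.
exact/differentiable_continuous/derivable1_diffP.
Unshelve. all: by end_near. Qed.

Lemma velocity_velocity_chart (c : R -> M) (t : R) i :
  (\near t, dom i (c t)) -> (\near t, derivable (chart i \o c) t 1) ->
  derivable (derive1 (chart i \o c)) t 1 ->
  let F := chart i \o c in
  is_second_order (velocity (velocity c) t) /\
  @chart _ _ (tangent (tangent M)) i (velocity (velocity c) t) =
    ((F t, derive1 F t), (derive1 F t, derive1 (derive1 F) t)).
Proof.
move=> ci dc ddc F; have vc := near_velocity_to_chart ci dc.
have Fc := differentiable_continuous ((derivable1_diffP _ _).1 (nbhs_singleton dc)).
have cj : \forall r \near t, dom (chart_at (c t)) (c r).
  by apply: (near_map ci Fc); apply: near_dom; exact: dom_chart_at.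
have E1 : {near t, (fun r => (F r, derive1 F r)) =1 chartT i \o velocity c}.
  by near=> r; rewrite /= tangent_chartE; congr pair; symmetry; near: r.
have [dp Dp] := derive1_pair (nbhs_singleton dc) ddc.
have [dj Dj] := velocity_to_chart (c := velocity c) (i := i : index (tangent M))
  tangent_atlas ci cj (near_eq_derivable E1 dp).
split.
  rewrite /is_second_order tangent_map_tau; congr pair.
  by rewrite -[LHS](derive1_comp_fst dj).
have E0 : chartT i (velocity c t) = (F t, derive1 F t) := esym (nbhs_singleton E1).
congr pair; first exact: E0.
by apply: etrans Dj _; rewrite -Dp; apply: esym; exact: derive1_near_eq.
Unshelve. all: by end_near. Qed.


Lemma to_chart_home x v : to_chart (chart_at x) x v = v.
Proof. by rewrite to_chartE dtrans_id//; exact: dom_chart_at. Qed.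

Lemma to_chart_home_tangent (p : tangent M) w : to_chart (chart_at p) p w = w.
Proof.
set i : index M := chart_at (tau p); have ip : dom i (tau p) := dom_chart_at _.
apply: (near_eq_diff_linear (g := (@id (E * E)))) => //.
  by move=> z; exact: cvg_id.
have := near_tangent_image ip (near_dom ip); apply: filterS => _ [y [v [iy _ ->]]].
rewrite -(tangent_chart_from_chart v iy) /=.
by rewrite (chart_invK _ (@inj_tangent_chart i) (y := tvec y _)).
Qed.

Lemma poly_family i x c1 c2 c3 c4 c5 : dom i x ->
  let q := family_poly (chart i x) c1 c2 c3 c4 c5 in
  [/\ chart_inv x i (q (0, 0)) = x,
      \forall z \near (0, 0), dom i (chart_inv x i (q z)) &
      {near (0, 0), q =1 chart i \o (chart_inv x i \o q)}].
Proof.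
move=> ix q; have qc : {for (0, 0), continuous q}.
  exact/differentiable_continuous/smooth_at_diff/smooth_at_family_poly.
have : \forall z \near (0, 0), exists y, [/\ dom i y, dom i y & q z = chart i y].
  have nx := near_image ix (near_dom ix).
  rewrite -(family_poly0 (chart i x) c1 c2 c3 c4 c5) in nx.
  exact: qc _ nx.
move=> nq; split.
- by rewrite /q family_poly0 chart_invK//; exact: inj_chart.
- by apply: filterS nq => z [y [iy _ ->]]; rewrite chart_invK//; exact: inj_chart.
- by apply: filterS nq => z [y [iy _ E]]; rewrite /= E chart_invK//; exact: inj_chart.
Qed.

Lemma family_jet (gamma : R * R -> M) i : let F := chart i \o gamma in
  (\forall z \near (0, 0), dom i (gamma z)) -> smooth_at F (0, 0) ->
  \forall s \near 0,
  [/\ chartT i (velocity (fun t => gamma (s, t)) 0) = (F (s, 0), 'D_(0, 1) F (s, 0)),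
     is_second_order (jet2 (fun t => gamma (s, t))) &
     @chart _ _ (tangent (tangent M)) i (jet2 (fun t => gamma (s, t))) =
       ((F (s, 0), 'D_(0, 1) F (s, 0)),
        ('D_(0, 1) F (s, 0), 'D_(0, 1) ('D_(0, 1) F) (s, 0)))].
Proof.
move=> F gi sF.
have := near_slice_fst (near_join gi); have := near_slice_fst (near_join (smooth_at_near sF)).
apply: filterS2 => s sFs gis.
have ci := near_slice_snd gis; have sFt := near_slice_snd sFs.
have dc : \forall t \near (0 : R), derivable (chart i \o (fun t => gamma (s, t))) t 1.
  by apply: filterS sFt => t /smooth_at_diff; exact: derivable_snd.
have D1 (G : R * R -> E) : derive1 (fun t => G (s, t)) = (fun t => 'D_(0, 1) G (s, t)).
  by apply/funext => t; exact: derive1_snd.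
have D1F : derive1 (chart i \o (fun t => gamma (s, t))) = (fun t => 'D_(0, 1) F (s, t)).
  exact: (D1 F).
have ddc : derivable (derive1 (chart i \o (fun t => gamma (s, t)))) 0 1.
  have dDF : differentiable ('D_(0, 1) F) (s, 0).
    by apply/smooth_at_diff/smooth_at_derive; exact: nbhs_singleton sFt.
  by rewrite D1F; exact: derivable_snd dDF.
have [so jE] := velocity_velocity_chart ci dc ddc.
rewrite /= D1F (D1 ('D_(0, 1) F)) in jE.
by split; [exact: (congr1 fst jE)|exact: so|exact: jE].
Qed.

(** The velocities of the curves gamma (s, .) are all read in the preferred
    chart of gamma (0, 0), uniformly in s, so that differentiating them in s
    is differentiating D_t F. *)
Lemma family_velocity (gamma : R * R -> M) : smooth_into_at gamma (0, 0) ->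
  let F := chart (chart_at (gamma (0, 0))) \o gamma in
  velocity (fun s => velocity (fun t => gamma (s, t)) 0) 0 =
    tvec (tvec (gamma (0, 0)) ('D_(0, 1) F (0, 0)))
         ('D_(1, 0) F (0, 0), 'D_(1, 0) ('D_(0, 1) F) (0, 0)).
Proof.
move=> [gi sF] F; set i := chart_at (gamma (0, 0)) in F gi sF *.
have jF := family_jet gi sF.
have [_ Dp] := derive1_fst_pair (smooth_at_diff sF)
  (smooth_at_diff (smooth_at_derive sF (0, 1))).
have E1 : velocity (fun t => gamma (0, t)) 0 =
    tvec (gamma (0, 0)) ('D_(0, 1) F (0, 0)).
  exact: (congr1 (tvec (gamma (0, 0))) (derive1_snd F 0 0)).
have E2 : derive1 (chartT i \o (fun s => velocity (fun t => gamma (s, t)) 0)) 0 =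
    ('D_(1, 0) F (0, 0), 'D_(1, 0) ('D_(0, 1) F) (0, 0)).
  apply: etrans (esym (derive1_near_eq _)) Dp.
  by apply: filterS jF => s [].
exact: (congr2 (@tvec _ _ (tangent M)) E1 E2).
Qed.

Lemma represents_exists (X : tangent (tangent M)) : exists gamma, represents gamma X.
Proof.
case: X => [[x v] [a b]]; have ix := dom_chart_at x; set i := chart_at x in ix.
(* The family q + s a + t v + s t b. *)
have [x0 ni qF] := poly_family a v b 0 0 ix.
set q := family_poly _ _ _ _ _ _ in x0 ni qF.
have sg : smooth_into_at (chart_inv x i \o q) (0, 0).
  split; rewrite [(_ \o _) (0, 0)]x0 //.
  by apply: smooth_at_eq qF _; exact: smooth_at_family_poly.
exists (chart_inv x i \o q); split=> //; apply: etrans (family_velocity sg) _.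
have g0 : (chart_inv x i \o q) (0, 0) = x by [].
have [[_ Ea] [Ev Eb _ _]] := family_poly_jet qF.
by rewrite g0 -/i Ea Ev Eb.
Qed.

Local Notation chart2 := (@chart R (E * E * E)%type (tangent2 M)).

Lemma family_tangent2 (gamma : R * R -> M) i (C : R -> tangent2 M) :
  let F := chart i \o gamma in
  (\forall z \near (0, 0), dom i (gamma z)) -> smooth_at F (0, 0) ->
  (\forall s \near 0, tt_of (C s) = jet2 (fun t => gamma (s, t))) ->
  chart2 i (C 0) = (F (0, 0), 'D_(0, 1) F (0, 0),
                    2^-1 *: 'D_(0, 1) ('D_(0, 1) F) (0, 0)) /\
  derive1 (chart2 i \o C) 0 =
    ('D_(1, 0) F (0, 0), 'D_(1, 0) ('D_(0, 1) F) (0, 0),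
     2^-1 *: 'D_(1, 0) ('D_(0, 1) ('D_(0, 1) F)) (0, 0)).
Proof.
move=> F gi sF CE; have jF := family_jet gi sF.
have E0 : {near 0, (fun s => (F (s, 0), 'D_(0, 1) F (s, 0),
    2^-1 *: 'D_(0, 1) ('D_(0, 1) F) (s, 0))) =1 chart2 i \o C}.
  apply: filterS2 CE jF => s CE [_ _ jE].
  rewrite /= -[RHS]/(tangent2_chart i (tt_of (C s))) /tangent2_chart CE.
  by rewrite [@chart _ _ _ _ _]jE.
split; first by rewrite (nbhs_singleton E0).
rewrite -(derive1_near_eq E0).
have dDF := smooth_at_derive sF (0, 1); have dDDF := smooth_at_derive dDF (0, 1).
have [dp Dp] := derive1_fst_pair (smooth_at_diff sF) (smooth_at_diff dDF).
have dZ := derivable_fst (smooth_at_diff dDDF).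
have [dk Dk] := derive1_scale 2^-1 dZ.
have [_ D2] := derive1_pair dp dk.
apply: etrans D2 _; rewrite Dp Dk; apply: (congr1 (pair _)); apply: (congr1 ( *:%R _)).
exact: derive1_fst.
Qed.

(** * The second-order tangent bundle *)

Definition to_tangent2 (u0 : tangent2 M) (w : tangent (tangent M)) : tangent2 M :=
  if pselect (is_second_order w) is left h
  then exist (fun w => `[< is_second_order w >]) w (asboolT h) else u0.

Lemma to_tangent2K u0 w : is_second_order w -> tt_of (to_tangent2 u0 w) = w.
Proof. by move=> h; rewrite /to_tangent2; case: pselect. Qed.

Lemma tangent2_second_order (u : tangent2 M) : is_second_order (tt_of u).
Proof. exact/asboolP/(valP u). Qed.

(** Realized by the 2-jet of the curve with expression q + t v + t^2 b, which
    avoids inverting the formula for the coordinates of a second-order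
    vector. *)
Lemma chart2_surj i y v b : dom i y ->
  exists u : tangent2 M, dom i (tau1 u) /\ chart2 i u = (chart i y, v, b).
Proof.
move=> iy; have [y0 ni qF] := poly_family 0 v 0 b 0 iy.
set g := chart_inv y i \o _ in y0 ni qF.
have sF : smooth_at (chart i \o g) (0, 0).
  by apply: smooth_at_eq qF _; exact: smooth_at_family_poly.
have [_ so _] := nbhs_singleton (family_jet ni sF).
pose u : tangent2 M := exist (fun w => `[< is_second_order w >]) _ (asboolT so).
have nC : \forall s \near (0 : R), tt_of (to_tangent2 u (jet2 (fun t => g (s, t)))) =
    jet2 (fun t => g (s, t)).
  by apply: filterS (family_jet ni sF) => s [_ sos _]; rewrite to_tangent2K.
have [c2E _] := family_tangent2 ni sF nC.
exists (to_tangent2 u (jet2 (fun t => g (0, t)))); split.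
  rewrite /tau1 /tau2 to_tangent2K//.
  exact: nbhs_singleton ni.
have [[E0 _] [Ev _ Eb _]] := family_poly_jet qF.
apply: etrans c2E _.
by rewrite E0 Ev Eb scalerA mulVf ?scale1r// pnatr_eq0.
Qed.

(** What makes the tangent maps of the projections of T^(2)M computable: the
    inverse of a chart of T^(2)M is unspecified off the image, which is a
    neighbourhood of each of its points. *)
Lemma near_chart2 i (u : tangent2 M) : dom i (tau1 u) ->
  \forall z \near chart2 i u, exists u', dom i (tau1 u') /\ chart2 i u' = z.
Proof.
move=> iu; have ni := near_image iu (near_dom iu).
have : \forall z \near chart2 i u, exists y, [/\ dom i y, dom i y & z.1.1 = chart i y].
  have n1 : \forall w \near (chart2 i u).1, exists y, [/\ dom i y, dom i y & w.1 = chart i y].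
    exact: (@near_fst _ _ (chart2 i u).1 _ ni).
  exact: (@near_fst _ _ (chart2 i u) _ n1).
apply: filterS => -[[e v] b] [y [iy _ /= ->]].
by have [u' [iu' u'E]] := chart2_surj v b iy; exists u'.
Qed.

Lemma tangent_map_tau2 (X : tangent (tangent2 M)) :
  tangent_map tau2 X = tvec (tau2 (tau X)) (fibre X).1.
Proof.
case: X => u w; apply: (congr1 (tvec (tau2 u))).
set i : index M := chart_at (tau1 u); have iu : dom i (tau1 u) := dom_chart_at _.
apply: (near_eq_diff_linear (g := (fst : E * E * E -> E * E))) => //.
  by move=> z; exact: cvg_fst.
apply: filterS (near_chart2 iu) => z [u' [iu' zE]].
have [E1 _] := chart_inv_image (N := tangent2 M) u (i := i) (ex_intro2 _ _ u' iu' zE).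
by rewrite /= -{1}E1.
Qed.

Lemma tangent_map_tau1 (X : tangent (tangent2 M)) :
  tangent_map tau1 X = tvec (tau1 (tau X)) (fibre X).1.1.
Proof.
case: X => u w; apply: (congr1 (tvec (tau1 u))).
set i : index M := chart_at (tau1 u); have iu : dom i (tau1 u) := dom_chart_at _.
apply: (near_eq_diff_linear (g := fun z : E * E * E => z.1.1)) => //.
  move=> z; apply: (@continuous_comp _ _ _ (fst : E * E * E -> E * E) fst); exact: cvg_fst.
apply: filterS (near_chart2 iu) => z [u' [iu' zE]].
have [E1 _] := chart_inv_image (N := tangent2 M) u (i := i) (ex_intro2 _ _ u' iu' zE).
by rewrite /= -{1}E1.
Qed.

Lemma adapted_coords (gamma : R * R -> M) (X : tangent (tangent2 M)) :
  adapted gamma X ->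
  let i := chart_at (tau1 (tau X)) in let F := chart i \o gamma in
  [/\ gamma (0, 0) = tau1 (tau X),
     \forall z \near (0, 0), dom i (gamma z), smooth_at F (0, 0),
     chart2 i (tau X) = (F (0, 0), 'D_(0, 1) F (0, 0),
                    2^-1 *: 'D_(0, 1) ('D_(0, 1) F) (0, 0)) &
     fibre X = ('D_(1, 0) F (0, 0), 'D_(1, 0) ('D_(0, 1) F) (0, 0),
        2^-1 *: 'D_(1, 0) ('D_(0, 1) ('D_(0, 1) F)) (0, 0))].
Proof.
move=> [[gi sF] gu [C [CE CX]]].
have g0 : gamma (0, 0) = tau1 (tau X) by exact: (congr1 (fun w => tau (tau w)) gu).
rewrite -g0; set i := chart_at (gamma (0, 0)) in gi sF *.
have [c2E dE] := family_tangent2 gi sF CE.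
have C0 : C 0 = tau X by exact: (congr1 tau CX).
have i0 : chart_at (C 0) = i :> index M by rewrite C0 /i g0.
have fE : derive1 (chart2 (chart_at (C 0)) \o C) 0 = fibre X := congr1 fibre CX.
rewrite i0 in fE; rewrite C0 in c2E.
by split; [by []|exact: gi|exact: sF|exact: c2E|exact: etrans (esym fE) dE].
Qed.

(** A 2-jet is recognized by its coordinates in the preferred chart: a vector
    of second order repeats v, and its last component is 2 y. *)
Lemma tangent2_home (u : tangent2 M) x q v b : tau1 u = x ->
  chart2 (chart_at x) u = (q, v, b) ->
  tt_of u = tvec (tvec x v) (v, 2 *: b).
Proof.
have := tangent2_second_order u; rewrite /is_second_order tangent_map_tau.
case: u => -[[y v'] [a b']] h /= [va]; rewrite /tau1 /tau2 /tt_of /= => <-.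
set j : index M := chart_at y => cE.
have {cE} : (chart j y, to_chart j y v',
    2^-1 *: (@to_chart _ _ (tangent M) j (y, v') (a, b')).2) = (q, v, b) := cE.
rewrite (to_chart_home y v') [to_chart _ _ _](to_chart_home_tangent (y, v') (a, b')).
by move=> [_ <- <-]; rewrite scalerA mulfV ?scale1r ?pnatr_eq0// va.
Qed.

Lemma adapted_exists (X : tangent (tangent2 M)) : exists gamma, adapted gamma X.
Proof.
set u := tau X; set x := tau1 u; have ix := dom_chart_at x; set i := chart_at x in ix.
set z := chart2 i u; set w := fibre X.
(* The family q + s a + t v + s t b + t^2 y + s t^2 d. *)
have [x0 ni qF] := poly_family w.1.1 z.1.2 w.1.2 z.2 w.2 ix.
set g := chart_inv x i \o _ in x0 ni qF.
have g0 : g (0, 0) = x by exact: x0.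
change (\forall p \near (0, 0), dom i (g p)) in ni.
have sF : smooth_at (chart i \o g) (0, 0).
  by apply: smooth_at_eq qF _; exact: smooth_at_family_poly.
exists g; have [[E0 Ea] [Ev Eb Ey Ec]] := family_poly_jet qF.
pose C s := to_tangent2 u (jet2 (fun t => g (s, t))).
have nC : \forall s \near (0 : R), tt_of (C s) = jet2 (fun t => g (s, t)).
  by apply: filterS (family_jet ni sF) => s [_ sos _]; rewrite to_tangent2K.
have [c2E dE] := family_tangent2 ni sF nC.
have half (e : E) : 2^-1 *: (2 *: e) = e by rewrite scalerA mulVf ?scale1r// pnatr_eq0.
have C1 : tau1 (C 0) = x.
  by rewrite /tau1 /tau2 (nbhs_singleton nC) -[LHS]/(g (0, 0)).
have C0 : C 0 = u.
  apply: val_inj; rewrite -[LHS]/(tt_of (C 0)) -[RHS]/(tt_of u).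
  have uE : tt_of u = tvec (tvec x z.1.2) (z.1.2, 2 *: z.2).
    apply: (@tangent2_home u x z.1.1); first by [].
    by rewrite -/i -/z; case: (z) => -[].
  by rewrite uE (tangent2_home C1 c2E) Ev Ey half.
split.
- split; first by rewrite g0.
  by rewrite g0.
- by rewrite -(nbhs_singleton nC) C0.
- exists C; split=> //.
  have dw : derive1 (chart2 (chart_at (C 0)) \o C) 0 = w.
    have -> : chart_at (C 0) = i :> index M by rewrite -[LHS]/(chart_at (tau1 (C 0))) C1.
    apply: etrans dE _; rewrite Ea Eb Ec half.
    by case: (w) => -[].
  apply: etrans (congr2 (@tvec _ _ (tangent2 M)) C0 dw) _.
  by rewrite /u /w; case: (X).
Qed.

End Manifold.

(** * Covariant derivatives in charts *)

Section Connection.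
Context {R : realType} {n : nat} {M : smoothManifold 'rV[R]_n}.
Context (nabla : affineConnection M).
Local Notation E := 'rV[R]_n.
Implicit Types (i j : index M) (x y : M) (p : tangent M).

Lemma to_chart_linear i y : linear (to_chart i y : E -> E).
Proof. exact: linearP. Qed.

Lemma from_chart_linear i y : linear (from_chart i y : E -> E).
Proof. exact: linearP. Qed.

Lemma smooth_field_at_add x (Y Z : M -> E) :
  smooth_field_at Y x -> smooth_field_at Z x ->
  smooth_field_at (fun y => Y y + Z y) x.
Proof.
move=> sY sZ; apply: smooth_at_eq (smooth_at_add sY sZ).
by near=> e; rewrite /= [RHS]linearD.
Unshelve. all: by end_near. Qed.

Lemma smooth_field_at_scale x (f : M -> R) (Y : M -> E) :
  smooth_fun_at f x -> smooth_field_at Y x ->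
  smooth_field_at (fun y => f y *: Y y) x.
Proof.
move=> sf sY; apply: smooth_at_eq (smooth_at_scale sf sY).
by near=> e; rewrite /= [RHS]linearZ.
Unshelve. all: by end_near. Qed.

Lemma smooth_field_at_zero x : smooth_field_at (fun=> 0 : E) x.
Proof.
apply: smooth_at_eq (smooth_at_cst (0 : E) (chart (chart_at x) x)).
by near=> e; rewrite /= [RHS]linear0.
Unshelve. all: by end_near. Qed.

Lemma smooth_field_at_eq x (Y Z : M -> E) :
  (\forall y \near (x : mpts M), Y y = Z y) ->
  smooth_field_at Y x -> smooth_field_at Z x.
Proof.
move=> YZ; apply: smooth_at_eq.
have := near_chart_inv x (dom_chart_at x) YZ.
by apply: filterS => e /= ->.
Qed.

(** The Leibniz rule applied to the (discontinuous) indicator function of the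
    set where the two fields agree: it is constant near the point, hence smooth
    there, and its products with the two fields are the same field. *)
Lemma nabla_germ p (Y Z : M -> E) : smooth_field_at Y (tau p) ->
  (\forall y \near (tau p : mpts M), Y y = Z y) -> nabla p Y = nabla p Z.
Proof.
move=> sY YZ; have sZ := smooth_field_at_eq YZ sY.
pose f (y : M) : R := if `[< Y y = Z y >] then 1 else 0.
have fYZ : (fun y => f y *: Y y) = (fun y => f y *: Z y).
  apply/funext => y; rewrite /f; case: asboolP => [->//|_].
  by rewrite !scale0r.
have f1 : \forall e \near chart (chart_at (tau p)) (tau p),
    1 = (f \o chart_inv (tau p) (chart_at (tau p))) e.
  have := near_chart_inv (tau p) (dom_chart_at (tau p)) YZ.
  by apply: filterS => e YZe; rewrite /= /f asboolT.
have sf : smooth_fun_at f (tau p).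
  by apply: smooth_at_eq f1 _; exact: smooth_at_cst.
have ftp : f (tau p) = 1 by rewrite /f asboolT//; exact: nbhs_singleton YZ.
have := congr1 (nabla p) fYZ; rewrite !nabla_leibniz// ftp !scale1r.
suff -> : dir_derive f p = 0 by rewrite !scale0r !add0r.
have [_ D] := near_eq_diff f1 (differentiable_cst _ _).
exact: etrans (congr1 (fun q : E -> R => q (fibre p)) D)
  (congr1 (fun q : E -> R => q (fibre p)) (diff_cst _ _)).
Qed.

Lemma nabla_zero p : nabla p (fun=> 0 : E) = 0.
Proof.
have := nabla_add nabla (smooth_field_at_zero (tau p)) (smooth_field_at_zero (tau p)).
have -> : (fun y : M => 0 + 0 : E) = (fun=> 0) by apply/funext => y; rewrite addr0.
by move/eqP; rewrite -subr_eq subrr => /eqP.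
Qed.

Lemma nabla_comb p m (f : 'I_m -> M -> R) (Z : 'I_m -> M -> E) :
  (forall k, smooth_fun_at (f k) (tau p)) ->
  (forall k, smooth_field_at (Z k) (tau p)) ->
  smooth_field_at (fun y => \sum_k f k y *: Z k y) (tau p) /\
  nabla p (fun y => \sum_k f k y *: Z k y) =
  \sum_k (dir_derive (f k) p *: Z k (tau p) + f k (tau p) *: nabla p (Z k)).
Proof.
move=> sf sZ.
have -> : (fun y => \sum_k f k y *: Z k y) = \sum_k (fun y => f k y *: Z k y).
  by apply/funext => y; rewrite fct_sumE.
elim/big_rec2 : _ => [|k v Y _ [sY nY]].
  by split; [exact: smooth_field_at_zero|exact: nabla_zero].
have sfZ := smooth_field_at_scale (sf k) (sZ k).
split; first exact: smooth_field_at_add.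
by rewrite -nY -nabla_leibniz//; exact: nabla_add.
Qed.

(** The field whose components in the chart i are constant. *)
Definition frozen i (w : E) : M -> E := fun y => from_chart i y w.

(** Seen from the preferred chart of x, with f the transition map from i and f'
    its inverse, the field is e |-> (D_w f)(f' e). *)
Lemma smooth_frozen i w x : dom i x -> smooth_field_at (frozen i w) x.
Proof.
move=> ix; set j := chart_at x; have jx : dom j x := dom_chart_at x.
have sij := smooth_transition x ix jx; have sji := smooth_transition x jx ix.
have E0 : chart i x = (chart i \o chart_inv x j) (chart j x).
  by rewrite /= chart_invK//; exact: inj_chart.
have sD : smooth_at ('D_w (chart j \o chart_inv x i))
    ((chart i \o chart_inv x j) (chart j x)).
  by rewrite -E0; exact: smooth_at_derive.
apply: smooth_at_eq (smooth_at_comp sji sD).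
have := near_image jx (near_dom ix); apply: filterS => e [y [jy iy ->]] /=.
rewrite chart_invK//; last exact: inj_chart.
rewrite deriveE; last exact/smooth_at_diff/smooth_transition.
by rewrite dtransE// /frozen to_chartE from_chartE dtrans_comp//; exact: dom_chart_at.
Qed.

Lemma nabla_frozen_linear i p : dom i (tau p) ->
  linear (fun w => nabla p (frozen i w)).
Proof.
move=> ip a w w'.
have -> : frozen i (a *: w + w') = (fun y => a *: frozen i w y + frozen i w' y).
  by apply/funext => y; rewrite /frozen [LHS]linearP.
have sa : smooth_fun_at (fun _ : M => a) (tau p) by exact: smooth_at_cst.
have sw := smooth_frozen w ip; have sw' := smooth_frozen w' ip.
rewrite nabla_add//; last exact: smooth_field_at_scale.
rewrite nabla_leibniz//.
suff -> : dir_derive (fun _ : M => a) p = 0 by rewrite scale0r add0r.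
exact: (congr1 (fun q : E -> R => q (fibre p)) (diff_cst _ _)).
Qed.

(** Expanding the field frozen in the preferred chart along the fields frozen
    in the chart i: its coefficients are the components of the differential of
    the transition map, and the Leibniz rule produces the second derivative
    of that map. *)
Lemma nabla_frozen_change i p a : dom i (tau p) ->
  let x := tau p in let j := chart_at x in
  nabla p (frozen j a) =
    from_chart i x ('D_(fibre p) ('D_a (chart i \o chart_inv x j)) (chart j x)) +
    nabla p (frozen i (dtrans j i x a)).
Proof.
move=> ix x j; have jx : dom j x := dom_chart_at x.
set phi := chart i \o chart_inv x j; have sphi : smooth_at phi (chart j x).
  exact: smooth_transition.
pose f (k : 'I_n) (y : M) : R := dtrans j i y a 0 k.
have fE k : {near chart j x, (fun e => ('D_a phi e) 0 k) =1 f k \o chart_inv x j}.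
  have := near_image jx (near_dom ix); apply: filterS => e [y [jy iy ->]] /=.
  rewrite chart_invK//; last exact: inj_chart.
  rewrite deriveE; last exact/smooth_at_diff/smooth_transition.
  by rewrite /phi dtransE.
have sf k : smooth_fun_at (f k) x.
  by apply: smooth_at_eq (fE k) _; exact/smooth_at_coord/smooth_at_derive.
have sZ k := smooth_frozen (delta_mx 0 k) ix.
have [sC nC] := nabla_comb sf sZ.
have near : \forall y \near (x : mpts M),
    \sum_k f k y *: frozen i (delta_mx 0 k) y = frozen j a y.
  apply: filterS2 (near_dom ix) (near_dom jx) => y iy jy; symmetry.
  rewrite /f /frozen from_chartE -(dtrans_comp a jy iy (dom_chart_at y)).
  exact: (linear_row_sum _ (from_chart_linear i y)).
rewrite -(nabla_germ sC near) nC big_split/=; congr (_ + _).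
  rewrite [RHS](linear_row_sum _ (from_chart_linear i x)).
  apply: eq_bigr => k _; congr (_ *: _).
  rewrite /dir_derive -deriveE; last first.
    apply: near_eq_differentiable (fE k) _.
    exact/smooth_at_diff/smooth_at_coord/smooth_at_derive.
  rewrite -(near_eq_derive _ (fE k)) derive_coord//.
  exact/smooth_at_diff/smooth_at_derive.
by rewrite [RHS](linear_row_sum _ (nabla_frozen_linear ix)).
Qed.

(** The Christoffel symbols of the chart i, contracted with u and w. *)
Definition christoffel i (y : M) (u w : E) : E :=
  to_chart i y (nabla (tvec y (from_chart i y u)) (frozen i w)).

Lemma christoffel_linearl i y w : dom i y -> linear (fun u => christoffel i y u w).
Proof.
move=> iy a u u'; rewrite /christoffel (from_chart_linear i y).
rewrite (nabla_linear nabla (smooth_frozen w iy)).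
exact: to_chart_linear.
Qed.

Lemma christoffel_linearr i y u : dom i y -> linear (christoffel i y u).
Proof.
move=> iy a w w'.
rewrite /christoffel (nabla_frozen_linear (p := tvec y _) iy).
exact: to_chart_linear.
Qed.

Lemma smooth_christoffel x u w : let i := chart_at x in
  smooth_at (fun e => christoffel i (chart_inv x i e) u w) (chart i x).
Proof.
move=> i; have ix : dom i x := dom_chart_at x.
exact: (nabla_smooth nabla (smooth_frozen u ix) (smooth_frozen w ix)).
Qed.

(** The coordinate expression w' + Gamma (c', w) of the covariant derivative
    is valid in every chart around the point, not only in the preferred one:
    differentiating the change of components of W between the two charts and
    expanding the frozen field produce the same second derivative of the
    transition map, with opposite signs. *)
Lemma covariant_derivative_chart (W : R -> tangent M) (t : R) i :
  let c := chart i \o (fun r => tau (W r)) in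
  let w := fun r => to_chart i (tau (W r)) (fibre (W r)) in
  (\forall r \near t, dom i (tau (W r))) -> derivable c t 1 -> derivable w t 1 ->
  to_chart i (tau (W t)) (fibre (covariant_derivative nabla W t)) =
    derive1 w t + christoffel i (tau (W t)) (derive1 c t) (w t).
Proof.
move=> c w ci dc dw; set x := tau (W t); set j := chart_at x.
have ix : dom i x := nbhs_singleton ci; have jx : dom j x := dom_chart_at x.
have cc := derivable1_continuous dc.
have cj : \forall r \near t, dom j (tau (W r)) by exact: near_map ci cc (near_dom jx).
have [dcj velE] := velocity_to_chart (manifold_atlas M) ci cj dc.
set cj' := chart j \o (fun r => tau (W r)) in dcj.
set v := velocity (fun r => tau (W r)) t in velE.
have vE : v = tvec x (derive1 cj' t) by [].
pose wj r := to_chart j (tau (W r)) (fibre (W r)).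
set psi := chart i \o chart_inv x j; set phi := chart j \o chart_inv x i.
have spsi : smooth_at psi (chart j x) by exact: smooth_transition.
have sphi : smooth_at phi (chart i x) by exact: smooth_transition.
have wjE : {near t, (fun r => 'd phi (c r) (w r)) =1 wj}.
  apply: filterS2 ci cj => r ir jr; rewrite /phi /c /= dtransE// /w /wj !to_chartE.
  by rewrite dtrans_comp//; exact: dom_chart_at.
have wiE : {near t, (fun r => 'd psi (cj' r) (wj r)) =1 w}.
  apply: filterS2 ci cj => r ir jr; rewrite /psi /cj' /= dtransE// /w /wj !to_chartE.
  by rewrite dtrans_comp//; exact: dom_chart_at.
have [dpw _] := derive1_differential sphi dc dw.
have dwj : derivable wj t 1 := near_eq_derivable wjE dpw.
have [_ Dw] := derive1_differential spsi dcj dwj.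
have wtE : wj t = fibre (W t) by exact: to_chart_home.
have Dw' := etrans (esym (derive1_near_eq wiE)) Dw.
have -> : fibre (covariant_derivative nabla W t) =
    derive1 wj t + nabla v (frozen j (fibre (W t))) by [].
rewrite (nabla_frozen_change (p := v) _ ix).
have tD a b : to_chart i x (a + b) = to_chart i x a + to_chart i x b :> E.
  by rewrite [LHS]linearD.
have tf a : to_chart i x (from_chart i x a) = a.
  by rewrite to_chartE from_chartE dtrans_comp ?dtrans_id//; exact: dom_chart_at.
have ft a : from_chart i x (to_chart i x a) = a.
  by rewrite to_chartE from_chartE dtrans_comp// dtrans_id.
have vE2 : v = tvec x (from_chart i x (derive1 c t)).
  by rewrite -[derive1 c t]velE ft.
rewrite tD tD tf addrA; apply: (congr2 +%R).
  by rewrite addrC -wtE; exact: esym Dw'.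
by rewrite {1}vE2.
Qed.

Local Notation variation := (@Defs.variation R E M).

Lemma near_variation_chart (gamma : R * R -> M) i : let F := chart i \o gamma in
  (\forall z \near (0, 0), dom i (gamma z)) -> smooth_at F (0, 0) ->
  \forall t \near (0 : R),
    to_chart i (gamma (0, t)) (fibre (variation gamma t)) = 'D_(1, 0) F (0, t).
Proof.
move=> F gi sF.
have := near_slice_snd (near_join gi); have := near_slice_snd (near_join (smooth_at_near sF)).
apply: filterS2 => t sFt git.
have ci := near_slice_fst git.
have dc : \forall s \near (0 : R), derivable (chart i \o (fun s => gamma (s, t))) s 1.
  by apply: filterS (near_slice_fst sFt) => s /smooth_at_diff; exact: derivable_fst.
apply: etrans (nbhs_singleton (near_velocity_to_chart ci dc)) _.
exact: (derive1_fst F).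
Qed.

Lemma near_covariant_variation (gamma : R * R -> M) i : let F := chart i \o gamma in
  (\forall z \near (0, 0), dom i (gamma z)) -> smooth_at F (0, 0) ->
  \forall t \near (0 : R),
    to_chart i (gamma (0, t)) (fibre (covariant_derivative nabla (variation gamma) t)) =
    'D_(0, 1) ('D_(1, 0) F) (0, t) +
    christoffel i (gamma (0, t)) ('D_(0, 1) F (0, t)) ('D_(1, 0) F (0, t)).
Proof.
move=> F gi sF.
have nd := near_join (near_slice_snd gi).
have nv := near_join (near_variation_chart gi sF).
have ns := near_slice_snd (smooth_at_near sF).
have nall : \forall t \near (0 : R), [/\ smooth_at F (0, t),
   \forall r \near t, dom i (gamma (0, r)) & \forall r \near t,
   to_chart i (gamma (0, r)) (fibre (variation gamma r)) = 'D_(1, 0) F (0, r)].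
  by apply: filterS3 nd nv ns.
apply: filterS nall => t [sFt git vt].
have dc : derivable (fun r => F (0, r)) t 1 by exact: derivable_snd (smooth_at_diff sFt).
have dD : derivable (fun r => 'D_(1, 0) F (0, r)) t 1.
  exact: derivable_snd (smooth_at_diff (smooth_at_derive sFt (1, 0))).
have vt' : {near t, (fun r => 'D_(1, 0) F (0, r)) =1
    (fun r => to_chart i (tau (variation gamma r)) (fibre (variation gamma r)))}.
  by apply: filterS vt => r ->.
have dw := near_eq_derivable vt' dD.
have := @covariant_derivative_chart (variation gamma) t i git dc dw.
rewrite -(derive1_near_eq vt') -(nbhs_singleton vt').
move=> E1; apply: etrans E1 _.
by rewrite (derive1_snd ('D_(1, 0) F)) -(derive1_snd F).
Qed.

Lemma K_of_familyE (gamma : R * R -> M) : smooth_into_at gamma (0, 0) ->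
  let x := gamma (0, 0) in let F := chart (chart_at x) \o gamma in
  K_of_family nabla gamma = tvec x ('D_(1, 0) ('D_(0, 1) F) (0, 0) +
    christoffel (chart_at x) x ('D_(0, 1) F (0, 0)) ('D_(1, 0) F (0, 0))).
Proof.
move=> [gi sF] x F; apply: (congr1 (tvec x)).
rewrite -[LHS](to_chart_home x) -(schwarz _ _ sF).
exact: nbhs_singleton (near_covariant_variation gi sF).
Qed.

(** The derivative at x along h of the contracted Christoffel symbols. *)
Definition dchristoffel (x : M) (h u w : E) : E :=
  let i := chart_at x in
  'D_h (fun e => christoffel i (chart_inv x i e) u w) (chart i x).

Lemma dchristoffel_linearr x h u : linear (dchristoffel x h u).
Proof.
move=> a w w'; rewrite /dchristoffel; set i := chart_at x.
pose G w e := christoffel i (chart_inv x i e) u w.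
have dG w1 : derivable (G w1) (chart i x) h.
  exact/diff_derivable/smooth_at_diff/smooth_christoffel.
have G_lin : {near chart i x, (fun e => a *: G w e + G w' e) =1 G (a *: w + w')}.
  have ix : dom i x := dom_chart_at x.
  have := near_chart_inv x ix (near_dom ix).
  by apply: filterS => e ie; rewrite /G (christoffel_linearr _ ie).
apply: etrans (esym (near_eq_derive h G_lin)) _.
have dZ := derivableZ (k := a) (dG w).
by rewrite [LHS](deriveD dZ (dG w')) [X in X + _](deriveZ a (dG w)).
Qed.

Lemma derive1_christoffel (c : R -> M) (p w : R -> E) (t : R) :
  let x := c t in let i := chart_at x in
  (\forall r \near t, dom i (c r)) -> derivable (chart i \o c) t 1 ->
  derivable p t 1 -> derivable w t 1 ->
  derivable (fun r => christoffel i (c r) (p r) (w r)) t 1 /\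
  derive1 (fun r => christoffel i (c r) (p r) (w r)) t =
    dchristoffel x (derive1 (chart i \o c) t) (p t) (w t) +
    christoffel i x (derive1 p t) (w t) + christoffel i x (p t) (derive1 w t).
Proof.
move=> x i ci dc dp dw.
have dcur u v : derivable (fun r => christoffel i (c r) u v) t 1 /\
    derive1 (fun r => christoffel i (c r) u v) t =
    dchristoffel x (derive1 (chart i \o c) t) u v.
  pose G e := christoffel i (chart_inv x i e) u v.
  have dG : differentiable G (chart i x) := smooth_at_diff (smooth_christoffel x u v).
  have [d D] : derivable (G \o (chart i \o c)) t 1 /\
      derive1 (G \o (chart i \o c)) t = 'D_(derive1 (chart i \o c) t) G (chart i x).
    exact: derive1_comp_curve dG dc.
  have E1 : {near t, G \o (chart i \o c) =1 (fun r => christoffel i (c r) u v)}.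
    apply: filterS ci => r ir; apply: (congr1 (fun y => christoffel i y u v)).
    exact: (chart_invK x (@inj_chart _ _ M i) ir).
  split; first exact: near_eq_derivable E1 d.
  rewrite /dchristoffel -/x -/i -/G -D; exact: esym (derive1_near_eq E1).
have linl v : \forall r \near t, linear (fun u => christoffel i (c r) u v).
  by apply: filterS ci => r; exact: christoffel_linearl.
have linr : \forall r \near t, linear (christoffel i (c r) (p r)).
  by apply: filterS ci => r; exact: christoffel_linearr.
have chr1 v := derive1_linear_family (linl v) (fun u => (dcur u v).1) dp.
have [dchr Dchr] := derive1_linear_family linr (fun v => (chr1 v).1) dw.
split; first exact: dchr.
apply: etrans Dchr _; apply: (congr1 (+%R^~ _)); apply: etrans (chr1 _).2 _.
by apply: (congr1 (+%R^~ _)); exact: (dcur _ _).2.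
Qed.

Definition K2_coord x (v y a b d : E) : E :=
  let christ := christoffel (chart_at x) x in
  d + 2^-1 *: (dchristoffel x v v a + christ (2 *: y) a + christ v b +
               christ v (b + christ v a)).

Lemma K2_coord_half x (v y a b d : E) : let i := chart_at x in
  K2_coord x v (2^-1 *: y) a b (2^-1 *: d) =
  2^-1 *: (d + (dchristoffel x v v a + christoffel i x y a + christoffel i x v b) +
           christoffel i x v (b + christoffel i x v a)).
Proof.
move=> i; have y2 : 2 *: (2^-1 *: y) = y.
  by rewrite scalerA mulfV ?scale1r ?pnatr_eq0.
by rewrite /K2_coord y2 -(addrA d) [RHS]scalerDr.
Qed.

(** The second covariant derivative of the variation field W is, in a chart,
    V' + Gamma (c', V) for V = W' + Gamma (c', W); the third derivatives of the
    family are reordered by the symmetry of second derivatives. *)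
Lemma K2_of_familyE (gamma : R * R -> M) : smooth_into_at gamma (0, 0) ->
  let x := gamma (0, 0) in let F := chart (chart_at x) \o gamma in
  K2_of_family nabla gamma = tvec x (K2_coord x ('D_(0, 1) F (0, 0))
    (2^-1 *: 'D_(0, 1) ('D_(0, 1) F) (0, 0))
    ('D_(1, 0) F (0, 0)) ('D_(1, 0) ('D_(0, 1) F) (0, 0))
    (2^-1 *: 'D_(1, 0) ('D_(0, 1) ('D_(0, 1) F)) (0, 0))).
Proof.
move=> [gi sF] x F; set i := chart_at x in F gi sF *.
have sFs := smooth_at_derive sF (1, 0); have sFt := smooth_at_derive sF (0, 1).
have dF : derivable (fun r => F (0, r)) 0 1 by exact: derivable_snd (smooth_at_diff sF).
have dFs := derivable_snd (smooth_at_diff sFs).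
have dFt := derivable_snd (smooth_at_diff sFt).
have dFst := derivable_snd (smooth_at_diff (smooth_at_derive sFs (0, 1))).
have git := near_slice_snd gi.
pose v : E := 'D_(0, 1) F (0, 0); pose a : E := 'D_(1, 0) F (0, 0).
pose b : E := 'D_(1, 0) ('D_(0, 1) F) (0, 0).
pose y : E := 'D_(0, 1) ('D_(0, 1) F) (0, 0).
pose d : E := 'D_(1, 0) ('D_(0, 1) ('D_(0, 1) F)) (0, 0).
have cE : derive1 (fun r => F (0, r)) 0 = v := derive1_snd F 0 0.
have vE : derive1 (fun r => 'D_(0, 1) F (0, r)) 0 = y := derive1_snd ('D_(0, 1) F) 0 0.
have aE : derive1 (fun r => 'D_(1, 0) F (0, r)) 0 = b := derive1_snd_fst sF.
have dE : derive1 (fun r => 'D_(0, 1) ('D_(1, 0) F) (0, r)) 0 = d := derive1_snd_snd_fst sF.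
have bE : 'D_(0, 1) ('D_(1, 0) F) (0, 0) = b := schwarz _ _ sF.
have [dchr Dchr] : derivable (fun r => christoffel i (gamma (0, r))
      ('D_(0, 1) F (0, r)) ('D_(1, 0) F (0, r))) 0 1 /\
    derive1 (fun r => christoffel i (gamma (0, r))
      ('D_(0, 1) F (0, r)) ('D_(1, 0) F (0, r))) 0 =
    dchristoffel x v v a + christoffel i x y a + christoffel i x v b.
  have [dC DC] := @derive1_christoffel (fun r => gamma (0, r)) _ _ 0 git dF dFt dFs.
  split; [exact: dC|apply: etrans DC _].
  exact: (congr2 +%R (congr2 +%R (congr1 (fun h => dchristoffel x h v a) cE)
    (congr1 (fun u => christoffel i x u a) vE)) (congr1 (christoffel i x v) aE)).
have [dV DV] := derive1_add dFst dchr.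
have VE := near_covariant_variation gi sF.
have VE' : {near (0 : R), (fun r => 'D_(0, 1) ('D_(1, 0) F) (0, r) +
    christoffel i (gamma (0, r)) ('D_(0, 1) F (0, r)) ('D_(1, 0) F (0, r))) =1
  (fun r => to_chart i (gamma (0, r))
     (fibre (covariant_derivative nabla (variation gamma) r)))}.
  by apply: filterS VE => r E; exact: esym E.
have dw := near_eq_derivable VE' dV.
have E2 := @covariant_derivative_chart (covariant_derivative nabla (variation gamma)) 0 i
  git dF dw.
have V0 := etrans (esym (nbhs_singleton VE'))
  (congr1 (fun q => q + christoffel i x v a) bE).
have DV0 := etrans (esym (derive1_near_eq VE')) (etrans DV (congr2 +%R dE Dchr)).
have {E2} E3 := etrans E2 (congr2 +%R DV0 (congr2 (christoffel i x) cE V0)).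
have E4 := eq_trans (esym (to_chart_home x _)) E3.
have K2E := K2_coord_half x v y a b d.
exact (congr1 (tvec x) (eq_trans (congr1 ( *:%R 2^-1) E4) (esym K2E))).
Qed.

(** * The connection maps *)

Definition K_coord (X : tangent (tangent M)) : tangent M :=
  let x := tau (tau X) in
  tvec x ((fibre X).2 + christoffel (chart_at x) x (fibre (tau X)) (fibre X).1).

(** The coordinates of K of a family involve the family only through the vector
    that it represents. *)
Lemma K_of_represents gamma X : represents gamma X -> K_of_family nabla gamma = K_coord X.
Proof. by move=> [sg <-]; rewrite (family_velocity sg) K_of_familyE. Qed.

Lemma connection_KE X : connection_K nabla X = K_coord X.
Proof.
have [gamma rg] := represents_exists X.
apply: xget_unique => [|_ [gamma' rg' ->]]; last exact: K_of_represents.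
by exists gamma => //; rewrite (K_of_represents rg).
Qed.

Definition K2_jet (X : tangent (tangent2 M)) : tangent M :=
  let u := tau X in let x := tau1 u in let w := fibre X in
  let y := (@chart _ _ (tangent2 M) (chart_at x) u).2 in
  tvec x (K2_coord x (fibre (tau2 u)) y w.1.1 w.1.2 w.2).

Lemma K2_of_adapted gamma X : adapted gamma X -> K2_of_family nabla gamma = K2_jet X.
Proof.
move=> aX; have [sg _ _] := aX; have [g0 _ _ zE wE] := adapted_coords aX.
rewrite (K2_of_familyE sg) /K2_jet wE g0.
have vE : fibre (tau2 (tau X)) = 'D_(0, 1) (chart (chart_at (tau1 (tau X))) \o gamma) (0, 0).
  exact (eq_trans (esym (to_chart_home (tau1 (tau X)) _)) (congr1 (fun z => z.1.2) zE)).
by rewrite vE zE.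
Qed.

Lemma connection_K2E X : connection_K2 nabla X = K2_jet X.
Proof.
have [gamma rg] := adapted_exists X.
apply: xget_unique => [|_ [gamma' rg' ->]]; last exact: K2_of_adapted.
by exists gamma => //; rewrite (K2_of_adapted rg).
Qed.

Lemma connection_K1E X : connection_K1 nabla X =
  let u := tau X in let x := tau1 u in let w := fibre X in
  tvec x (w.1.2 + christoffel (chart_at x) x (fibre (tau2 u)) w.1.1).
Proof. by rewrite /connection_K1 connection_KE tangent_map_tau2. Qed.

Lemma K2_coord_linear x (v y : E) :
  linear (fun w : E * E * E => K2_coord x v y w.1.1 w.1.2 w.2).
Proof.
move=> c [[a b] d] [[a' b'] d']; rewrite /K2_coord /=.
have cl u := christoffel_linearr u (dom_chart_at x).
rewrite dchristoffel_linearr !cl.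
have -> : c *: b + b' + (c *: christoffel (chart_at x) x v a +
    christoffel (chart_at x) x v a') = c *: (b + christoffel (chart_at x) x v a) +
   (b' + christoffel (chart_at x) x v a').
  by rewrite scalerDr addrACA.
by rewrite cl; apply/rowP => k; rewrite !mxE; ring.
Qed.

Lemma K2_almost_tangent X : connection_K2 nabla (almost_tangent X) = connection_K1 nabla X.
Proof.
rewrite connection_K2E connection_K1E /K2_jet /K2_coord /=.
set x := tau1 (tau X); set v := fibre (tau2 (tau X)).
have cl u := christoffel_linearr u (dom_chart_at x).
rewrite (linear_zero (cl _)) (linear_zero (dchristoffel_linearr _ _ _)).
rewrite (linear_zero (cl _)) !addr0 !add0r.
apply: (congr1 (fun q => tvec x (_ + q))).
move: (christoffel _ _ _ _) => e.
by rewrite -[e + e]/(e *+ 2) -(scaler_nat 2 e) scalerA mulVf ?scale1r ?pnatr_eq0.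
Qed.

Lemma K1_almost_tangent X : connection_K1 nabla (almost_tangent X) = tangent_map tau1 X.
Proof.
rewrite connection_K1E tangent_map_tau1 /=.
by rewrite (linear_zero (christoffel_linearr _ (dom_chart_at _))) addr0.
Qed.

Lemma K1_fibrewise_linear : fibrewise_linear tau1 (connection_K1 nabla).
Proof.
split=> [X|u c w w']; first by rewrite connection_K1E.
rewrite !connection_K1E /= (christoffel_linearr _ (dom_chart_at _)).
by rewrite scalerDr addrACA.
Qed.

Lemma K2_fibrewise_linear : fibrewise_linear tau1 (connection_K2 nabla).
Proof.
split=> [X|u c w w']; first by rewrite connection_K2E.
by rewrite !connection_K2E; exact: K2_coord_linear.
Qed.

End Connection.

Theorem mainTheorem1 (R : realType) (n : nat)
    (M : smoothManifold 'rV[R]_n)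
    (g : riemannianMetric M) (nabla : affineConnection M)
    (nabla_LC : levi_civita g nabla) :
  (* K and K2 are well defined by arbitrary families *)
  [/\ forall X : tangent (tangent M), exists gamma, represents gamma X,
      forall (X : tangent (tangent M)) gamma, represents gamma X ->
        connection_K nabla X = K_of_family nabla gamma,
      forall X : tangent (tangent2 M), exists gamma, adapted gamma X &
      forall (X : tangent (tangent2 M)) gamma, adapted gamma X ->
        connection_K2 nabla X = K2_of_family nabla gamma] /\
  is_connection_map2 (connection_K1 nabla) (connection_K2 nabla).
Proof.
split; split.
- exact: represents_exists.
- by move=> X gamma rg; rewrite connection_KE (K_of_represents nabla rg).
- exact: adapted_exists.
- by move=> X gamma ag; rewrite connection_K2E (K2_of_adapted nabla ag).
- exact: K1_fibrewise_linear.
- exact: K2_fibrewise_linear.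
- exact: K2_almost_tangent.
- exact: K1_almost_tangent.
Qed.
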